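(* Let $r\ge 1$, let $d'<d$ be natural numbers and let $\tau$ be an $r$-type all of whose members $(B,b)$ satisfy that $B$ has maximum degree at most $d'$. Then $\tau$-neighbourhood freeness is uniformly testable on the class $\mathcal{C}_d$ with constant running time.
   Context: $\mathcal{C}_d$ is the class of finite simple undirected graphs of maximum degree at most $d$. For a graph $G$ and vertex $v$, $N_r^G(v)$ is the set of vertices at distance at most $r$ from $v$ and $\mathcal{N}_r^G(v)$ the subgraph induced by it. An $r$-ball is a pair $(B,b)$ of a graph $B$ and $b\in V(B)$ such that every vertex of $B$ has distance at most $r$ from $b$; two $r$-balls are isomorphic if there is a graph isomorphism mapping centre to centre. An $r$-type is an isomorphism class of $r$-balls; $v$ has $r$-type $\tau$ in $G$ if $(\mathcal{N}_r^G(v),v)\in\tau$. $G$ is $\tau$-neighbourhood free if no vertex of $G$ has type $\tau$. A graph on $n$ vertices is $\epsilon$-far from a property $\mathcal{P}$ if more than $\epsilon dn$ edge insertions/deletions are needed to obtain an $n$-vertex graph of $\mathcal{P}$. The algorithm gets $n$ and oracle access answering queries $(v,i)$, $i\le d$, with the $i$-th neighbour of $v$ (or a special symbol). Uniformly testable with constant running time means: there is a single probabilistic algorithm which, given $\epsilon\in(0,1]$, $n$, and oracle access to $G\in\mathcal{C}_d$ on $n$ vertices, accepts with probability at least $2/3$ if $G$ has the property and rejects with probability at least $2/3$ if $G$ is $\epsilon$-far from it, and whose running time is bounded by a function of $\epsilon$ (for fixed $d,\tau$), independent of $n$. *)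

(* Defs.v *)
From HB Require Import structures.
From mathcomp Require Import all_boot all_order all_algebra.
From mathcomp Require Import reals.
Set Implicit Arguments.
Unset Strict Implicit.
Unset Printing Implicit Defensive.
Import Order.TTheory GRing.Theory Num.Theory.

Record graph (V : finType) := Graph {
  edge : rel V;
  edge_sym : symmetric edge;
  edge_irr : irreflexive edge }.

Section Graphs.
Variable V : finType.
Implicit Types G H : graph V.

Definition max_degree G : nat := \max_(v : V) #|[set w | edge G v w]|.

Definition edge_set G : {set {set V}} :=
  [set e | [exists x, exists y, edge G x y && (e == [set x; y])]].

(* Least number of edge insertions and deletions turning G into H. *)
Definition edit_dist G H : nat :=
  #|(edge_set G :\: edge_set H) :|: (edge_set H :\: edge_set G)|.

(* dist_le G r x y: some walk of length at most r leads from x to y, i.e. the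
   distance of x and y is at most r. *)
Definition dist_le G (r : nat) (x y : V) : bool :=
  [exists k : 'I_r.+1, exists p : k.-tuple V,
    path (edge G) x p && (last x p == y)].

Definition nbhd G (r : nat) (v : V) : {set V} := [set w | dist_le G r v w].

Lemma nbhd_centre G r v : v \in nbhd G r v.
Proof.
rewrite inE; apply/existsP; exists ord0; apply/existsP; exists [tuple].
by rewrite /= eqxx.
Qed.

Definition induced_edge G (A : {set V}) : rel {x : V | x \in A} :=
  fun x y => edge G (val x) (val y).

Lemma induced_sym G A : symmetric (@induced_edge G A).
Proof. by move=> x y; apply: edge_sym. Qed.

Lemma induced_irr G A : irreflexive (@induced_edge G A).
Proof. by move=> x; apply: edge_irr. Qed.

Definition induced G (A : {set V}) : graph {x : V | x \in A} :=
  Graph (@induced_sym G A) (@induced_irr G A).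

End Graphs.

(* A pair (B, b) of a finite graph and one of its vertices. *)
Record rooted := Rooted {
  bvertex : finType;
  bgraph : graph bvertex;
  centre : bvertex }.

Definition is_ball (r : nat) (B : rooted) : Prop :=
  forall x, dist_le (bgraph B) r (centre B) x.

Definition rooted_iso (B C : rooted) : Prop :=
  exists f : bvertex B -> bvertex C,
    [/\ bijective f,
        forall x y, edge (bgraph C) (f x) (f y) = edge (bgraph B) x y
      & f (centre B) = centre C].

Record rtype (r : nat) := RType {
  rtype_mem :> rooted -> Prop;
  rtype_class : exists2 B, is_ball r B &
    forall C, rtype_mem C <-> is_ball r C /\ rooted_iso B C }.

Definition nbhd_ball (V : finType) (G : graph V) (r : nat) (v : V) : rooted :=
  Rooted (induced G (nbhd G r v)) (exist _ v (nbhd_centre G r v)).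

Definition has_type r (tau : rtype r) (V : finType) (G : graph V) (v : V) :
  Prop := tau (nbhd_ball G r v).

Definition graph_property := forall n : nat, graph 'I_n -> Prop.

Definition nbhd_free r (tau : rtype r) : graph_property :=
  fun n G => forall v : 'I_n, ~ has_type tau G v.

(* Adjacency lists giving, for each vertex, some enumeration without
   repetition of its neighbours; the order is arbitrary. *)
Definition adj_lists n (G : graph 'I_n) (adj : 'I_n -> seq 'I_n) : Prop :=
  forall v, uniq (adj v) /\ adj v =i edge G v.

(* Probabilistic random access machines with a structured syntax. The memory
   is an array of natural numbers, initially all 0. Every command costs one
   step; an expression is evaluated within the step of its command, which is
   only a constant factor since expressions are part of the fixed program. In
   a bounded number of steps all values stay polynomial in the number n of
   vertices, so unit cost arithmetic agrees, up to a factor independent of n,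
   with arithmetic on words of O(log n) bits. *)

Inductive binop := Add | Sub | Mul | Div | Mod | Eq | Le.

Inductive expr :=
  | Const of nat
  | Nvert                   (* the number of vertices of the input graph *)
  | Cell of expr            (* the content of a cell, by indirect addressing *)
  | Bin of binop & expr & expr
  | LeEps of expr & expr.   (* LeEps a b is 1 if a <= eps * b, and 0 if not *)

Inductive cmd :=
  | Skip
  | Store of expr & expr              (* Store a e: cell a becomes e *)
  | Query of expr & expr & expr       (* Query a v i: cell a becomes the
                                         answer to the query (v, i) *)
  | Rand of expr & expr               (* Rand a k: cell a becomes a uniformly
                                         random number below k *)
  | Seq of cmd & cmd
  | If of expr & cmd & cmd
  | While of expr & cmd.

Definition memory := nat -> nat.

(* The commands still to be executed, and the memory. *)
Definition config := (seq cmd * memory)%type.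

Definition binop_eval (o : binop) (x y : nat) : nat :=
  match o with
  | Add => x + y
  | Sub => x - y
  | Mul => x * y
  | Div => x %/ y
  | Mod => x %% y
  | Eq => x == y
  | Le => x <= y
  end.

Definition update (m : memory) (a x : nat) : memory :=
  fun b => if b == a then x else m b.

Section Semantics.
Variables (R : realType) (eps : R) (n d : nat) (adj : 'I_n -> seq 'I_n).

(* Vertices are numbered 0, ..., n - 1 and neighbours 0, ..., d - 1. The
   answer is w + 1 if the i-th neighbour of v is w; the special symbol is 0. *)
Definition oracle (v i : nat) : nat :=
  if insub v is Some u then
    if i < d then nth 0 [seq (val w).+1 | w <- adj u] i else 0
  else 0.

Fixpoint eval (m : memory) (e : expr) : nat :=
  match e with
  | Const k => k
  | Nvert => n
  | Cell a => m (eval m a)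
  | Bin o a b => binop_eval o (eval m a) (eval m b)
  | LeEps a b => ((eval m a)%:R <= eps * (eval m b)%:R)%R
  end.

(* The successors of a configuration, all equally likely. A random choice
   below 0 is read as a random choice below 1. *)
Definition step (c : config) : seq config :=
  let: (k, m) := c in
  match k with
  | [::] => [:: c]
  | Skip :: k => [:: (k, m)]
  | Store a e :: k => [:: (k, update m (eval m a) (eval m e))]
  | Query a v i :: k =>
      [:: (k, update m (eval m a) (oracle (eval m v) (eval m i)))]
  | Rand a e :: k =>
      [seq (k, update m (eval m a) x) | x <- iota 0 (maxn 1 (eval m e))]
  | Seq c1 c2 :: k => [:: (c1 :: c2 :: k, m)]
  | If e c1 c2 :: k => [:: ((if eval m e != 0 then c1 else c2) :: k, m)]
  | While e c :: k =>
      [:: (if eval m e != 0 then c :: While e c :: k else k, m)]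
  end.

Definition halted (c : config) : bool := nilp c.1.

(* A halted computation accepts if cell 0 is nonzero, and rejects if not. *)
Definition verdict (c : config) : bool := c.2 0 != 0.

Definition start (p : cmd) : config := ([:: p], fun=> 0).

(* Whatever the random choices are, c halts after at most t steps. *)
Fixpoint halts_within (t : nat) (c : config) : bool :=
  halted c || (if t is t'.+1 then all (halts_within t') (step c) else false).

(* Probability that c halts after at most t steps with verdict b. *)
Fixpoint prob (b : bool) (t : nat) (c : config) : R :=
  if halted c then (verdict c == b)%:R%R
  else if t is t'.+1 then
    ((\sum_(c' <- step c) prob b t' c') / (size (step c))%:R)%R
  else 0%R.

End Semantics.

Local Open Scope ring_scope.

(* The property is restricted to graphs of maximum degree at most d. *)
Definition eps_far (R : realType) (d : nat) (P : graph_property) (eps : R)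
    n (G : graph 'I_n) : Prop :=
  forall H : graph 'I_n, (max_degree H <= d)%N -> P n H ->
    eps * d%:R * n%:R < (edit_dist G H)%:R.

Definition uniformly_testable_const_time (R : realType) (d : nat)
    (P : graph_property) : Prop :=
  exists (p : cmd) (T : R -> nat), forall eps : R, 0 < eps <= 1 ->
    forall n (G : graph 'I_n) (adj : 'I_n -> seq 'I_n),
      (max_degree G <= d)%N -> adj_lists G adj ->
      [/\ halts_within eps d adj (T eps) (start p),
          P n G -> 2 / 3 <= prob eps d adj true (T eps) (start p)
        & eps_far d P eps G ->
            2 / 3 <= prob eps d adj false (T eps) (start p)].

(* Main.v *)
Require Import Defs.
From mathcomp Require Import all_boot all_order all_algebra.
From mathcomp Require Import zify ring lra.
From mathcomp Require Import boolp reals.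
Set Implicit Arguments.
Unset Strict Implicit.
Unset Printing Implicit Defensive.
Import Order.TTheory GRing.Theory Num.Theory.

(** The tester samples O(1 / eps) vertices and rejects if one of them has type
    tau. It is correct because a graph G with n vertices, n large, can be made
    tau-free by O(1) edits per vertex of type tau. A vertex of type tau sees only
    degrees at most d' < d within distance r - 1, so edits whose endpoints all
    end up with degree d create no new vertex of type tau, provided that no
    vertex sees an edited pair at distance exactly r; inserting edges between
    distant vertices and cutting a vertex off from all its neighbours are such
    edits. To destroy the type of v, cut off 2d pairwise distant vertices
    whose neighbours have the same degrees, bring these neighbours back to
    degree d by regular graphs between them, put a K_(d,d) on the 2d vertices,
    and route (d - deg v) / 2 edges of a matching of the K_(d,d) through v.

    Parity is the only obstruction: if d - deg v is odd, another vertex u of odd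
    deficiency is treated together with v. If there is none then d n is odd, and
    u is produced by inserting, next to the K_(d,d), an isolated vertex and a
    tau-free graph of odd order. If no such graph exists, then no graph of odd
    order is tau-free and, for odd n, the tester always rejects. *)

(** * Distances and balls *)

Section Distance.
Variable V : finType.
Implicit Types (G H : graph V) (x y z v w : V).

Definition deg G v := #|[set w | edge G v w]|.

Lemma max_degreeP G d : reflect (forall v, deg G v <= d) (max_degree G <= d).
Proof.
apply: (iffP (bigmax_leqP _ _ _)) => [h v|h v _]; last exact: h.
exact: (h v).
Qed.

Lemma dist_leP G k x y :
  reflect (exists p, [/\ size p <= k, path (edge G) x p & last x p = y])
          (dist_le G k x y).
Proof.
apply: (iffP existsP) => [[j /existsP[p /andP[pp /eqP lp]]]|[p [sp pp lp]]].
  by exists p; rewrite size_tuple -ltnS ltn_ord.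
have sp' : size p < k.+1 by [].
exists (Ordinal sp'); apply/existsP; exists (in_tuple p).
by rewrite /= pp lp eqxx.
Qed.

Lemma dist_le_refl G k x : dist_le G k x x.
Proof. by apply/dist_leP; exists [::]. Qed.

Lemma dist_le0 G x y : dist_le G 0 x y = (x == y).
Proof.
by apply/dist_leP/eqP => [[[|w p] [//]]|<-]; last by exists [::].
Qed.

Lemma dist_leW G j k x y : j <= k -> dist_le G j x y -> dist_le G k x y.
Proof.
move=> jk /dist_leP[p [sp pp lp]]; apply/dist_leP; exists p; split=> //.
exact: leq_trans jk.
Qed.

Lemma dist_leD G j k x y z :
  dist_le G j x y -> dist_le G k y z -> dist_le G (j + k) x z.
Proof.
move=> /dist_leP[p [sp pp lp]] /dist_leP[q [sq pq lq]].
apply/dist_leP; exists (p ++ q).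
by rewrite size_cat leq_add // cat_path pp lp pq last_cat lp lq.
Qed.

Lemma dist_le_edge G x y : edge G x y -> dist_le G 1 x y.
Proof. by move=> e; apply/dist_leP; exists [:: y]; rewrite /= e. Qed.

Lemma dist_leSP G k x y :
  reflect (exists2 z, dist_le G k x z & (z == y) || edge G z y)
          (dist_le G k.+1 x y).
Proof.
apply: (iffP idP) => [/dist_leP[p]|[z xz /orP[/eqP<-|e]]].
- case/lastP: p => [[_ _ <-]|p w].
    by exists x; rewrite ?dist_le_refl ?eqxx.
  rewrite size_rcons last_rcons rcons_path => -[sp /andP[pp e] <-].
  by exists (last x p); [apply/dist_leP; exists p|rewrite e orbT].
- exact: dist_leW xz.
- rewrite -addn1; apply: dist_leD xz _; exact: dist_le_edge.
Qed.

Lemma dist_le_sym G k x y : dist_le G k x y = dist_le G k y x.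
Proof.
suff h x' y' : dist_le G k x' y' -> dist_le G k y' x' by apply/idP/idP; apply: h.
elim: k x' y' => [|k IH] x' y'; first by rewrite !dist_le0 eq_sym.
case/dist_leSP => z /IH zx /orP[/eqP<-|e]; first exact: dist_leW zx.
rewrite -add1n; apply: dist_leD zx; apply: dist_le_edge; by rewrite edge_sym.
Qed.

Lemma dist_le_closed G (X : {set V}) k x y :
  (forall a b, a \in X -> edge G a b -> b \in X) ->
  x \in X -> dist_le G k x y -> y \in X.
Proof.
move=> cX xX; elim: k y => [|k IH] y; first by rewrite dist_le0 => /eqP<-.
by case/dist_leSP => z /IH zX /orP[/eqP<-//|]; apply: cX.
Qed.

Lemma card_nbhd G d k x : max_degree G <= d -> #|nbhd G k x| <= d.+1 ^ k.
Proof.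
move=> /max_degreeP hd; elim: k => [|k IH].
  have -> : nbhd G 0 x = [set x] by apply/setP => y; rewrite !inE dist_le0 eq_sym.
  by rewrite cards1.
pose N1 z := z |: [set w | edge G z w].
have sub : nbhd G k.+1 x \subset \bigcup_(z in nbhd G k x) N1 z.
  apply/subsetP => y; rewrite inE => /dist_leSP[z xz zy].
  by apply/bigcupP; exists z; rewrite !inE // eq_sym.
apply: leq_trans (subset_leq_card sub) _.
apply: (@leq_trans (\sum_(z in nbhd G k x) d.+1)).
  apply: (@leq_trans (\sum_(z in nbhd G k x) #|N1 z|)).
    elim/big_rec2: _ => [|z m A _ le]; first by rewrite cards0.
    apply: leq_trans (leq_card_setU _ _) _; lia.
  apply: leq_sum => z _; rewrite /N1 cardsU1; have := hd z; rewrite /deg.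
  case: (_ \notin _) => /=; lia.
by rewrite sum_nat_const expnSr leq_mul2r IH orbT.
Qed.

End Distance.

(** * Types as embeddings, and local surgery *)

Section Types.
Variables (r : nat) (tau : rtype r).

(* An isomorphism from B to the r-ball of v, given as an embedding into V so that
   no subtype of V is involved. *)
Definition ball_emb (B : rooted) (V : finType) (G : graph V) (v : V)
    (f : bvertex B -> V) : Prop :=
  [/\ injective f,
      forall x y, edge G (f x) (f y) = edge (bgraph B) x y,
      f (centre B) = v
    & forall w, dist_le G r v w <-> exists b, f b = w].

(** A walk of length at most [r] from [v] has all its vertices in the ball, so it is also a walk of
    the induced subgraph. *)
Lemma nbhd_ball_is_ball (V : finType) (G : graph V) v :
  is_ball r (nbhd_ball G r v).
Proof.
suff h k w (hw : w \in nbhd G r v) : k <= r -> dist_le G k v w ->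
    dist_le (induced G (nbhd G r v)) k (exist _ v (nbhd_centre G r v))
            (exist _ w hw).
  by case=> w hw /=; apply: h => //; rewrite inE in hw.
elim: k w hw => [|k IH] w hw kr.
  rewrite dist_le0 => /eqP e; subst w; rewrite dist_le0; apply/eqP; exact: val_inj.
case/dist_leSP => z vz zw.
have hz : z \in nbhd G r v by rewrite inE; apply: dist_leW vz; lia.
apply/dist_leSP; exists (exist _ z hz); first by apply: IH => //; lia.
by case/orP: zw => [e|e]; apply/orP; [left|right].
Qed.

Lemma rtype_emb : exists2 B, tau B &
  forall (V : finType) (G : graph V) v,
    has_type tau G v <-> exists f, @ball_emb B V G v f.
Proof.
have [B ballB tauP] := rtype_class tau.
exists B.
  apply/tauP; split=> //; exists id; split=> //; exact: (Bijective (g := id)).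
move=> V G v; split.
  case/tauP => _ [f [bijf ef cf]].
  exists (fun b => val (f b)); split.
  - by move=> x y /val_inj /(bij_inj bijf).
  - by move=> x y; rewrite -ef.
  - by rewrite cf.
  - move=> w; split=> [vw|[b <-]]; last by have := valP (f b); rewrite inE.
    have hw : w \in nbhd G r v by rewrite inE.
    have [g _ gK] := bijf.
    by exists (g (exist _ w hw)); rewrite gK.
case=> f [injf ef cf imf]; apply/tauP; split; first exact: nbhd_ball_is_ball.
have inN b : f b \in nbhd G r v by rewrite inE; apply/imf; exists b.
pose F b : {x : V | x \in nbhd G r v} := exist _ (f b) (inN b).
have injF : injective F by move=> x y [] /injf.
have surF (w : {x : V | x \in nbhd G r v}) : exists b, F b == w.
  have /imf[b e] : dist_le G r v (val w) by have := valP w; rewrite inE.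
  by exists b; apply/eqP/val_inj.
exists F; split.
- exists (fun w => xchoose (surF w)) => [b|w].
    by apply: injF; apply/eqP; exact: (xchooseP (surF (F b))).
  by apply/eqP; exact: (xchooseP (surF w)).
- by move=> x y; rewrite /= /induced_edge /= ef.
- exact: val_inj.
Qed.

Lemma has_type_same_ball (V : finType) (G H : graph V) z :
  (forall w, dist_le G r z w = dist_le H r z w) ->
  (forall x y, dist_le G r z x -> dist_le G r z y -> edge G x y = edge H x y) ->
  has_type tau H z -> has_type tau G z.
Proof.
have [B _ tP] := rtype_emb => dE eE /tP[f [injf ef cf imf]].
apply/tP; exists f; split=> // [x y|w]; last by rewrite dE; apply: imf.
by rewrite -ef eE // dE; apply/imf; [exists x|exists y].
Qed.

(** The image of [g] is closed under adjacency in [H], so the ball of [g q] lies in it and is a copy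
    of the ball of [q]. Hence a tau-free graph inserted as a component contains no vertex of type
    [tau]. *)
Lemma has_type_component (U V : finType) (Q : graph U) (H : graph V) g q :
  injective g -> (forall i y, edge H (g i) y <-> exists2 j, y = g j & edge Q i j) ->
  has_type tau H (g q) -> has_type tau Q q.
Proof.
have [B _ tP] := rtype_emb => injg gP /tP[f [injf ef cf imf]].
have gE i j : edge H (g i) (g j) = edge Q i j.
  apply/idP/idP => [/gP[j' /injg<-]//|e]; by apply/gP; exists j.
have dE k y : dist_le H k (g q) y <-> exists2 j, y = g j & dist_le Q k q j.
  elim: k y => [|k IH] y.
    rewrite dist_le0; split=> [/eqP<-|[j ->]]; first by exists q; rewrite ?dist_le0.
    by rewrite dist_le0 => /eqP->.
  split=> [/dist_leSP[z /IH[i -> qi] /orP[/eqP<-|/gP[j -> e]]]|].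
  - by exists i => //; apply: dist_leW qi.
  - by exists j => //; apply/dist_leSP; exists i; rewrite ?e ?orbT.
  case=> j -> /dist_leSP[i qi ij]; apply/dist_leSP; exists (g i).
    by apply/IH; exists i.
  by rewrite (inj_eq injg) gE.
have preim b : exists j, g j == f b.
  by have /dE[j -> _] : dist_le H r (g q) (f b) by [apply/imf; exists b]; exists j.
pose h b := xchoose (preim b).
have hK b : g (h b) = f b by apply/eqP/(xchooseP (preim b)).
apply/tP; exists h; split.
- by move=> x y e; apply: injf; rewrite -!hK e.
- by move=> x y; rewrite -gE !hK.
- by apply: injg; rewrite hK.
move=> w; split=> [qw|[b <-]].
  have /imf[b e] : dist_le H r (g q) (g w) by apply/dE; exists w.
  by exists b; apply: injg; rewrite hK.
have /dE[j e qj] : dist_le H r (g q) (f b) by apply/imf; exists b.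
suff <- : j = h b by [].
by apply: injg; rewrite hK.
Qed.

Variable d' : nat.
Hypothesis hr : 1 <= r.
Hypothesis htau : forall B : rooted, tau B -> max_degree (bgraph B) <= d'.

(** All neighbours of a vertex at distance at most [r - 1] still lie in the [r]-ball, so its whole
    degree is visible in [B]. *)
Lemma has_type_deg (V : finType) (G : graph V) z w :
  has_type tau G z -> dist_le G r.-1 z w -> deg G w <= d'.
Proof.
have [B tB tP] := rtype_emb => /tP[f [injf ef cf imf]] zw.
have [b fb] : exists b, f b = w by apply/imf; apply: dist_leW zw; lia.
apply: leq_trans (elimT (max_degreeP _ _) (htau tB) b).
rewrite /deg -(card_imset _ injf); apply: subset_leq_card; apply/subsetP => y.
rewrite inE => wy; have [c fc] : exists c, f c = y.
  apply/imf; rewrite -(prednK hr); apply/dist_leSP; exists w => //.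
  by rewrite wy orbT.
by apply/imsetP; exists c; rewrite // inE -ef fb fc.
Qed.

(* Since D has large degrees in H, a vertex of type tau in H can see D only at
   distance exactly r, where the last two hypotheses forbid a change of its
   ball. *)
Lemma surgery (V : finType) (G H : graph V) (D X : {set V}) :
  (forall x y, edge G x y != edge H x y -> x \in D) ->
  (forall x, x \in D -> x \notin X -> d' < deg H x) ->
  (forall x y, x \in X -> edge H x y -> y \in X) ->
  (forall x y, edge G x y -> ~~ edge H x y ->
    (forall w, edge G x w -> w \in D) \/ (forall w, edge G y w -> w \in D)) ->
  (forall x y, edge H x y -> ~~ edge G x y -> x \notin X -> y \notin X ->
    ~~ dist_le G (r + r) x y) ->
  forall z, z \notin X -> has_type tau H z -> has_type tau G z /\ z \notin D.
Proof.
move=> hD hdeg hX hdel hadd z zX tz.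
have reachX k w : dist_le H k z w -> w \notin X.
  move=> zw; apply: contra zX => wX; apply: (dist_le_closed hX wX).
  by rewrite dist_le_sym; apply: zw.
have far w : dist_le H r.-1 z w -> w \notin D.
  move=> zw; apply/negP => wD; have := has_type_deg tz zw.
  by rewrite leqNgt hdeg // (reachX _ _ zw).
have eE x y : x \notin D -> edge G x y = edge H x y.
  by move=> xD; apply/eqP; apply: contraNT xD; apply: hD.
(* Each edge of a walk of length at most [r] from [z] starts at distance at most [r - 1], hence
   outside [D], where [G] and [H] agree. *)
have dE k w : k <= r -> dist_le G k z w = dist_le H k z w.
  elim: k w => [|k IH] w kr; first by rewrite !dist_le0.
  apply/dist_leSP/dist_leSP => -[y zy yw]; exists y.
  - by rewrite -IH //; lia.
  - rewrite IH ?(ltnW kr) // in zy.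
    by rewrite -eE //; apply: far; apply: dist_leW zy; lia.
  - by rewrite IH //; lia.
  - by rewrite eE //; apply: far; apply: dist_leW zy; lia.
have zD : z \notin D by apply: far; apply: dist_le_refl.
split=> //.
(* Such an [x] is out of reach: the vertex before it on a walk would lie in [D] at distance at most
   [r - 1]. *)
have noD x : (forall w, edge G x w -> w \in D) -> x \in D -> ~~ dist_le G r z x.
  move=> hx xD; apply/negP; rewrite -(prednK hr) => /dist_leSP[y].
  rewrite dE ?leq_pred // => /far yD /orP[/eqP e|].
    by rewrite e xD in yD.
  by rewrite edge_sym => /hx; apply/negP.
apply: has_type_same_ball tz => [w|x y zx zy]; first exact: dE.
apply/idP/idP => [g|h]; apply/negPn/negP => n.
- have xD : x \in D by apply: (hD _ y); rewrite g (negbTE n).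
  have yD : y \in D.
    by apply: (hD _ x); rewrite edge_sym g edge_sym (negbTE n).
  by case: (hdel _ _ g n) => /noD; [move/(_ xD)|move/(_ yD)] => /negP.
- have := hadd _ _ h n; rewrite dE // in zx; rewrite dE // in zy.
  move/(_ (reachX _ _ zx) (reachX _ _ zy))/negP; apply.
  by apply: (dist_leD (y := z)); rewrite ?(dist_le_sym _ _ x) dE.
Qed.

End Types.

(** * Edit distance and rerouting through a complete bipartite component *)

Section EditDistance.
Variable V : finType.
Implicit Types (G H K : graph V).

Lemma edit_dist_refl G : edit_dist G G = 0.
Proof. by rewrite /edit_dist setDv setU0 cards0. Qed.

Lemma edit_dist_trans G H K :
  edit_dist G K <= edit_dist G H + edit_dist H K.
Proof.
apply: leq_trans (leq_card_setU _ _); apply: subset_leq_card.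
apply/subsetP => e; rewrite !(in_setU, in_setD).
by case: (e \in edge_set G); case: (e \in edge_set H); case: (e \in edge_set K).
Qed.

(** By symmetry both ends of a changed pair lie in [D], so the changed edges come from ordered pairs
    of elements of [D]. *)
Lemma edit_dist_within G H (D : {set V}) :
  (forall x y, edge G x y != edge H x y -> x \in D) ->
  edit_dist G H <= #|D| ^ 2.
Proof.
move=> hD; rewrite -mulnn -cardsX.
apply: leq_trans (leq_imset_card (fun p => [set p.1; p.2]) _).
apply: subset_leq_card; apply/subsetP => e.
have aux G1 G2 : (forall x y, edge G1 x y != edge G2 x y -> x \in D) ->
    e \in edge_set G1 -> e \notin edge_set G2 ->
    e \in [set [set p.1; p.2] | p in setX D D].
  move=> hD'; rewrite inE => /existsP[x /existsP[y /andP[xy /eqP->]]].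
  rewrite inE negb_exists => /forallP/(_ x).
  rewrite negb_exists => /forallP/(_ y); rewrite eqxx andbT => n.
  apply/imsetP; exists (x, y) => //; rewrite !inE /=; apply/andP; split.
    by apply: (hD' _ y); rewrite xy (negbTE n).
  by apply: (hD' _ x); rewrite edge_sym xy edge_sym (negbTE n).
case/setUP => /setDP[] i n; [apply: aux i n|apply: aux i n] => //.
by move=> x y h; apply: (hD x y); rewrite eq_sym.
Qed.

End EditDistance.

(** * Regular graphs on residues *)

Lemma card_ordE (P : pred nat) n : #|[set j : 'I_n | P j]| = count P (iota 0 n).
Proof.
rewrite -sum1_card big_mkcond /= -sum1_count [RHS]big_mkcond /=.
rewrite -[in RHS](subn0 n) (big_mkord xpredT (fun i => if P i then 1 else 0)).
by apply: eq_bigr => i _; rewrite inE.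
Qed.

Lemma card_ord_odd d b : #|[set j : 'I_d.*2 | odd j == b]| = d.
Proof.
rewrite (card_ordE (fun j => odd j == b)).
elim: d => // d IH; rewrite doubleS -addn2 iotaD count_cat IH /=.
rewrite !add0n /= odd_double; case: b {IH} => /=; lia.
Qed.

(** For even [N >= 2k], joining residues [i] and [j] when [i + j] is one of [1, 3, ..., 2k - 1]
    gives a [k]-regular graph: for fixed [i] the sum takes every residue once, and [i + i] is even,
    which excludes loops. *)
Definition circ N k (i j : nat) : bool :=
  let s := (i + j) %% N in odd s && (s < k.*2).

Lemma circ_sym N k : symmetric (circ N k).
Proof. by move=> i j; rewrite /circ addnC. Qed.

Lemma circ_irr N k i : ~~ odd N -> circ N k i i = false.
Proof.
move=> eN; rewrite /circ odd_mod; last exact: negbTE.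
by rewrite addnn odd_double.
Qed.

Lemma card_circ N k (i : 'I_N) :
  ~~ odd N -> k.*2 <= N -> #|[set j : 'I_N | circ N k i j]| = k.
Proof.
move=> eN kN; have N0 : 0 < N by case: (i) => ? /=; lia.
pose h (j : 'I_N) := Ordinal (ltn_pmod (i + j) N0).
have injh : injective h.
  move=> j j' /(congr1 val) /= /eqP; rewrite eqn_modDl !modn_small // => /eqP.
  exact: val_inj.
have -> : [set j : 'I_N | circ N k i j] =
    h @^-1: [set s : 'I_N | odd s && (s < k.*2)].
  by apply/setP => j; rewrite !inE.
rewrite on_card_preimset; last by apply: onW_bij; apply: injF_bij.
rewrite (card_ordE (fun s => odd s && (s < k.*2))) -(subnKC kN) iotaD count_cat.
rewrite -[RHS]addn0; congr (_ + _).
  rewrite -[RHS](card_ord_odd k true) (card_ordE (fun s => odd s == true)).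
  apply: eq_in_count => s; rewrite mem_iota; case: (odd s) => /=; lia.
rewrite -[LHS]add0n; apply/eqP; rewrite -leqn0 add0n leqNgt -has_count.
by apply/hasPn => s; rewrite mem_iota; lia.
Qed.

Section Kill.
Variables (r d' d : nat) (tau : rtype r).
Hypothesis hr : 1 <= r.
Hypothesis hd : d' < d.
Hypothesis htau : forall B : rooted, tau B -> max_degree (bgraph B) <= d'.

(* The matching {0,1}, {2,3}, ..., {e-2,e-1} of a component K_(d,d) is removed
   and its i-th endpoint is joined to [stub i] instead. *)
Lemma kill (V : finType) (G : graph V) (f : 'I_d.*2 -> V) (stub : nat -> V) e :
  max_degree G <= d -> injective f ->
  (forall i y, edge G (f i) y <-> exists2 j, y = f j & odd i != odd j) ->
  ~~ odd e -> e <= d.*2 ->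
  (forall i j, i < e -> stub i != f j) ->
  (forall i, i < e -> deg G (stub i) +
     #|[set j : 'I_d.*2 | (j < e) && (stub j == stub i)]| = d) ->
  exists H : graph V, [/\ max_degree H <= d, edit_dist G H <= d.*2.*2 ^ 2 &
    forall z, has_type tau H z ->
      has_type tau G z /\ forall i, i < e -> z != stub i].
Proof.
move=> /max_degreeP dG injf fP eE ed stubf stubd.
(* Indices with equal halves form the pairs {0,1}, {2,3}, ...; the case [i = j] is harmless since
   [G] has no loops. *)
pose del p q := [exists i : 'I_d.*2, exists j : 'I_d.*2,
  [&& p == f i, q == f j, i./2 == j./2 & (i < e) && (j < e)]].
pose add p q := [exists i : 'I_d.*2, (i < e) &&
  ((p == f i) && (q == stub i) || (q == f i) && (p == stub i))].
pose he p q := edge G p q && ~~ del p q || add p q.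
have delC p q : del p q = del q p.
  by apply/existsP/existsP => -[i /existsP[j /and4P[a b c /andP[l m]]]]; exists j;
    apply/existsP; exists i; rewrite a b l m eq_sym c.
have he_sym : symmetric he.
  move=> p q; rewrite /he edge_sym delC; congr (_ || _).
  by apply: eq_existsb => i; rewrite orbC.
have he_irr : irreflexive he.
  move=> p; rewrite /he edge_irr /=; apply/existsP => -[i /andP[ie]].
  by case/orP => /andP[/eqP-> /eqP E]; have := stubf i i ie; rewrite E eqxx.
pose H := Graph he_sym he_irr.
pose K := [set f i | i in [set: 'I_d.*2]].
pose U := [set stub i | i : 'I_d.*2 in [set j : 'I_d.*2 | j < e]].
have inK i : f i \in K by apply/imsetP; exists i.
have inU i : i < e -> stub i \in U.
  move=> ie; have id : i < d.*2 by apply: leq_trans ed.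
  by apply/imsetP; exists (Ordinal id); rewrite ?inE.
have UK x : x \in U -> x \notin K.
  case/imsetP => i; rewrite inE => ie ->; apply/imsetP => -[j _ E].
  by have := stubf i j ie; rewrite E eqxx.
have diff x y : edge G x y != edge H x y -> x \in K :|: U.
  rewrite /= /he inE; case: (boolP (add x y)) => [/existsP[i /andP[ie h]] _|_].
    by case/orP: h => /andP[/eqP E /eqP E']; rewrite ?E ?E' ?inK ?inU ?orbT.
  case: (boolP (del x y)) => [/existsP[i /existsP[j /andP[/eqP-> _]]]|_].
    by rewrite inK.
  by rewrite orbF andbT eqxx.
have clK x y : x \in K -> edge G x y -> y \in K.
  by case/imsetP => i _ -> /fP[j -> _].
have addf (i : 'I_d.*2) y : add (f i) y = (i < e) && (y == stub i).
  apply/existsP/idP => [[j /andP[je /orP[/andP[/eqP/injf-> ->]|/andP[_ /eqP E]]]]|].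
  - by rewrite je.
  - by have := stubf j i je; rewrite E eqxx.
  - by case/andP => ie s; exists i; rewrite ie s eqxx.
have degK i : deg H (f i) = d.
  (* The mate of [i] is the other index with the same half. It is on the opposite side and, [e]
     being even, lies below [e] together with [i]. *)
  have mate : exists j : 'I_d.*2, odd i != odd j /\ forall k : 'I_d.*2,
      (odd i != odd k) && (i./2 == k./2) = (k == j).
    have [j0 [l oj hj]] : exists j0,
        [/\ j0 < d.*2, odd j0 = ~~ odd i & j0./2 = i./2].
      have := ltn_ord i; case: (boolP (odd i)) => oi il.
        by exists i.-1; split; lia.
      by exists i.+1; split; lia.
    by exists (Ordinal l); split=> [|k]; rewrite -?val_eqE /=; lia.
  have [j [oij jP]] := mate.
  pose O := [set k : 'I_d.*2 | odd k == ~~ odd i].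
  have cO : #|O| = d by rewrite card_ord_odd.
  have jO : j \in O by rewrite inE; lia.
  have ne : i < e -> j < e.
    have := jP j; rewrite eqxx => /andP[_ /eqP]; lia.
  have -> : deg H (f i) = #|if i < e then stub i |: [set f k | k in O :\ j]
                            else [set f k | k in O]|.
    congr #|pred_of_set _|; apply/setP => y; rewrite inE /= /he addf.
    case: (ltnP i e) => ie /=.
    - rewrite !inE orbC; congr (_ || _); apply/idP/imsetP.
        case/andP => /fP[k -> oik] n; exists k => //; rewrite !inE.
        apply/andP; split; last by lia.
        apply: contra n => /eqP ->.
        apply/existsP; exists i; apply/existsP; exists j; rewrite !eqxx ie ne //.
        by have := jP j; rewrite eqxx => /andP[_ ->].
      case=> k; rewrite !inE => /andP[kj ok] ->; apply/andP; split.
        by apply/fP; exists k => //; lia.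
      apply: contra kj => /existsP[i' /existsP[k' /and4P[]]].
      by move=> /eqP/injf <- /eqP/injf <- h _; rewrite -jP h; lia.
    - rewrite orbF; apply/idP/imsetP.
        case/andP => /fP[k -> oik] n; exists k => //; rewrite !inE; lia.
      case=> k; rewrite !inE => ok ->; apply/andP; split.
        by apply/fP; exists k => //; lia.
      apply/existsP => -[i' /existsP[k' /and4P[/eqP/injf <- _ _]]].
      by rewrite ltnNge ie.
  case: ifP => ie; last by rewrite card_imset.
  have nin : stub i \notin [set f k | k in O :\ j].
    by apply/imsetP => -[k _ E]; have := stubf i k ie; rewrite E eqxx.
  by rewrite cardsU1 nin card_imset // -[RHS]cO (cardsD1 j O) jO.
(* No edge of [G] joins [x] to [K]. So [x] keeps its old edges and gains one for every [j < e] with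
   [stub j = x], which fills its degree up to [d]. *)
have degU x : x \in U -> deg H x = d.
  move=> xU; have xK := UK x xU; case/imsetP: (xU) => i; rewrite inE => ie xE.
  rewrite -(stubd i ie) -xE /deg.
  rewrite -(card_imset [set j : 'I_d.*2 | (j < e) && (stub j == x)] injf).
  rewrite -cardsUI [X in _ + X](_ : _ = 0) ?addn0; last first.
    apply/eqP; rewrite cards_eq0; apply/eqP/setP => y; rewrite !inE.
    apply/andP => -[xy /imsetP[k _ yE]].
    by move: xy; rewrite edge_sym => /(clK y x); rewrite yE inK (negbTE xK) => /(_ isT).
  congr #|pred_of_set _|; apply/setP => y; rewrite !inE /= /he; congr (_ || _).
    have -> : del x y = false; last by rewrite andbT.
    by apply/existsP => -[k /existsP[l /andP[/eqP E]]]; rewrite E inK in xK.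
  apply/existsP/imsetP => [[k /andP[ke /orP[]/andP[/eqP E /eqP E']]]|[k]].
  - by rewrite E inK in xK.
  - by exists k; rewrite // inE ke E' eqxx.
  - by rewrite inE => /andP[ke /eqP E] ->; exists k; rewrite ke E !eqxx orbT.
exists H; split.
- apply/max_degreeP => x; case: (boolP (x \in K :|: U)) => [|xD].
    by case/setUP => [/imsetP[i _ ->]|/degU->//]; rewrite degK.
  rewrite (_ : deg H x = deg G x) //; congr #|pred_of_set _|; apply/setP => y.
  by rewrite !inE; apply/eqP; apply: contraNT xD; rewrite eq_sym; apply: diff.
- apply: leq_trans (edit_dist_within diff) _; rewrite leq_exp2r //.
  apply: leq_trans (leq_card_setU _ _) _; rewrite -addnn; apply: leq_add.
    by rewrite card_imset // cardsT card_ord.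
  apply: leq_trans (leq_imset_card _ _) _.
  by apply: leq_trans (max_card _) _; rewrite card_ord.
- move=> z tz; suff [tGz zD] : has_type tau G z /\ z \notin K :|: U.
    split=> // i ie; apply: contra zD => /eqP->.
    by rewrite inE inU ?orbT.
  (* All of [K] and [U] has degree [d > d'] in [H], so no exceptional set is needed. Deleted edges
     lie inside the closed set [K]; inserted ones join [K] to [U], between which [G] has no walk at
     all. *)
  apply: (surgery hr htau diff (X := set0)) tz; rewrite ?inE //.
  + by move=> x /setUP[/imsetP[i _ ->]|/degU->//] _; rewrite degK.
  + by move=> x y; rewrite inE.
  + move=> x y xy; rewrite /= /he xy /= negb_or negbK.
    case/andP => /existsP[i /existsP[j /andP[/eqP-> _]]] _; left => w iw.
    by rewrite inE (clK _ _ _ iw) // inK.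
  + move=> x y; rewrite /= /he => /orP[/andP[->//]|/existsP[i /andP[ie h]]] _ _ _.
    have far : ~~ dist_le G (r + r) (f i) (stub i).
      by apply: contra (UK _ (inU i ie)) => /(dist_le_closed clK (inK i)).
    by case/orP: h => /andP[/eqP-> /eqP->]; rewrite // dist_le_sym.
Qed.

End Kill.

(** * Inserting a component *)

(** Greedy choice: each chosen vertex rules out at most [b] vertices of [A]. *)
Lemma far_family (V : finType) (G : graph V) rho b m (A : {set V}) :
  0 < b -> (forall x, #|nbhd G rho x| <= b) -> m * b <= #|A| ->
  exists s : seq V, [/\ size s = m, {subset s <= A} &
    pairwise (fun x y => ~~ dist_le G rho x y) s].
Proof.
move=> b0 hb; elim: m A => [|m IH] A; first by exists [::].
rewrite mulSn => hA.
have /card_gt0P[x xA] : 0 < #|A| by lia.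
have hA' : m * b <= #|A :\: nbhd G rho x|.
  have := cardsID (nbhd G rho x) A.
  have := subset_leq_card (subsetIr A (nbhd G rho x)); have := hb x; lia.
have [s [ss sA sp]] := IH _ hA'.
exists (x :: s); split=> /=; first by rewrite ss.
- move=> y; rewrite inE => /orP[/eqP->//|/sA]; by rewrite inE => /andP[].
- rewrite sp andbT; apply/allP => y /sA; by rewrite !inE => /andP[].
Qed.

Lemma pigeonhole (V C : finType) (c : V -> C) (A : {set V}) m :
  0 < #|C| -> #|C| * m <= #|A| ->
  exists k, m <= #|[set x in A | c x == k]|.
Proof.
move=> C0 hA; apply/existsP; apply: contraLR hA; rewrite negb_exists -ltnNge.
move=> /forallP h.
have -> : #|A| = \sum_k #|[set x in A | c x == k]|.
  rewrite -sum1_card (partition_big c xpredT) //=; apply: eq_bigr => k _.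
  by rewrite -sum1_card; apply: eq_bigl => x; rewrite inE.
case: m h => [|m] h; first by have /card_gt0P[k _] := C0; have := h k.
apply: (@leq_ltn_trans (\sum_(k : C) m)).
  by apply: leq_sum => k _; have := h k; rewrite -ltnNge.
by rewrite sum_nat_const ltn_pmul2l.
Qed.

Section Insert.
Variables (r d' d : nat) (tau : rtype r).
Hypothesis hr : 1 <= r.
Hypothesis hd : d' < d.
Hypothesis htau : forall B : rooted, tau B -> max_degree (bgraph B) <= d'.

Variables (N : nat) (Q : graph 'I_N).
Hypothesis evenN : ~~ odd N.
Hypothesis dN : d.*2 <= N.
Hypothesis dQ : max_degree Q <= d.

(* N pairwise distant vertices are cut off and carry a copy of Q. Since their
   neighbours have the same degrees position by position, the former neighbours
   in a given position can be brought to degree d by a regular graph. *)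
Lemma insert_at_family (V : finType) (G : graph V) (g : 'I_N -> V) :
  max_degree G <= d ->
  (forall i j, i != j -> ~~ dist_le G (1 + (r + r + 1)) (g i) (g j)) ->
  (forall i j, [seq deg G y | y <- enum [set y | edge G (g i) y]] =
               [seq deg G y | y <- enum [set y | edge G (g j) y]]) ->
  exists H : graph V, [/\ max_degree H <= d, edit_dist G H <= (N * d.+1) ^ 2,
    (forall i y, edge H (g i) y <-> exists2 j, y = g j & edge Q i j),
    (forall w, (forall i, ~~ dist_le G 1 (g i) w) -> edge H w =1 edge G w) &
    (forall z, has_type tau H z -> has_type tau G z \/ exists i, z = g i)].
Proof.
move=> /max_degreeP dG gfar gprof.
pose nb x := enum [set y | edge G x y].
have nbE x y : (y \in nb x) = edge G x y by rewrite mem_enum inE.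
(* The closed neighbourhoods of two members of the family are more than [2r] apart. *)
have sep i j p q : dist_le G 1 (g i) p -> dist_le G (r + r) p q ->
    dist_le G 1 (g j) q -> i = j.
  move=> ip pq jq; apply/eqP; apply: contraT => /gfar/negP; case.
  by apply: dist_leD ip (dist_leD pq _); rewrite dist_le_sym.
have sep0 i j p : dist_le G 1 (g i) p -> dist_le G 1 (g j) p -> i = j.
  by move=> a b; apply: sep a (dist_le_refl _ _ _) b.
have injg : injective g.
  by move=> i j E; apply: (sep0 i j (g i)); rewrite ?E dist_le_refl.
have gg i j : edge G (g i) (g j) = false.
  apply/negP => e; have E : i = j.
    by apply: (sep0 i j (g j)); rewrite ?dist_le_refl // dist_le_edge.
  by rewrite E edge_irr in e.
have profE i j p q : edge G (g i) p -> edge G (g j) q ->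
    index p (nb (g i)) = index q (nb (g j)) -> deg G p = deg G q.
  move=> ip jq E; have := congr1 (fun s => nth 0 s (index p (nb (g i)))) (gprof i j).
  rewrite -!/(nb _) (nth_map p) ?index_mem ?nbE // nth_index ?nbE //.
  by rewrite E (nth_map q) ?index_mem ?nbE // nth_index ?nbE.
(* A neighbour [p] of the family loses one edge, hence the successor: [dl p] new edges bring it to
   degree [d]. *)
pose dl p := (d - deg G p).+1.
(* A copy of [circ N (dl p)] on the neighbours in one position; equal profiles make [dl] agree at
   both ends, so [F] is symmetric. *)
pose F p q := [exists i, exists j, [&& edge G (g i) p, edge G (g j) q,
  index p (nb (g i)) == index q (nb (g j)) & circ N (dl p) i j]].
have FC p q : F p q -> F q p.
  case/existsP => i /existsP[j /and4P[ip jq /eqP E c]].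
  apply/existsP; exists j; apply/existsP; exists i.
  by rewrite ip jq E eqxx circ_sym /dl -(profE i j p q) // c.
pose X := [set g i | i in [set: 'I_N]].
have inX i : g i \in X by apply/imsetP; exists i.
pose FQ p q := [exists i, exists j, [&& p == g i, q == g j & edge Q i j]].
pose he p q := if (p \in X) || (q \in X) then FQ p q else edge G p q || F p q.
have he_sym : symmetric he.
  move=> p q; rewrite /he orbC edge_sym; case: ifP => _.
    by apply/existsP/existsP => -[i /existsP[j /and3P[a b c]]]; exists j;
      apply/existsP; exists i; rewrite a b edge_sym.
  by congr (_ || _); apply/idP/idP; apply: FC.
have he_irr : irreflexive he.
  move=> p; rewrite /he; case: ifP => _.
    apply/existsP => -[i /existsP[j /and3P[/eqP-> /eqP/injg->]]].
    by rewrite edge_irr.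
  rewrite edge_irr /=; apply/existsP => -[i /existsP[j /and4P[ip jp _]]].
  rewrite (sep0 i j p) ?dist_le_edge //; by rewrite circ_irr.
pose H := Graph he_sym he_irr.
have gH i y : edge H (g i) y <-> exists2 j, y = g j & edge Q i j.
  rewrite /= /he inX /=; split=> [/existsP[i' /existsP[j /and3P[/eqP/injg<-]]]|].
    by move=> /eqP-> e; exists j.
  case=> j -> e; apply/existsP; exists i; apply/existsP; exists j.
  by rewrite !eqxx.
pose D := \bigcup_i (g i |: [set y | edge G (g i) y]).
have inD i y : dist_le G 1 (g i) y -> y \in D.
  case/dist_leSP => z; rewrite dist_le0 => /eqP<- h.
  by apply/bigcupP; exists i => //; rewrite !inE eq_sym.
have DP y : y \in D -> exists2 i, dist_le G 1 (g i) y & (y == g i) || edge G (g i) y.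
  case/bigcupP => i _; rewrite !inE => h; exists i => //.
  by apply/dist_leSP; exists (g i); rewrite ?dist_le_refl // eq_sym.
have clX x y : x \in X -> edge H x y -> y \in X.
  by case/imsetP => i _ -> /gH[j -> _].
have diff x y : edge G x y != edge H x y -> x \in D.
  case: (boolP (x \in X)) => [/imsetP[i _ ->] _|xX].
    by apply: inD; apply: dist_le_refl.
  case: (boolP (y \in X)) => [yX|yX].
    have -> : edge H x y = false.
      by apply/negP; rewrite edge_sym => /(clX y x yX); apply/negP.
    rewrite eqbF_neg negbK edge_sym.
    case/imsetP: yX => i _ -> e; apply: inD; exact: dist_le_edge e.
  rewrite /= /he (negbTE xX) (negbTE yX) /=.
  case: (boolP (F x y)) => [/existsP[i /existsP[j /andP[ix _]]] _|_].
    by apply: inD; apply: dist_le_edge ix.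
  by rewrite orbF eqxx.
have degD p : p \in D -> p \notin X -> deg H p = d.
  case/DP => i ip1 /orP[/eqP->|ip] pX; first by rewrite inX in pX.
  have d0 : 0 < deg G p.
    by apply/card_gt0P; exists (g i); rewrite inE edge_sym.
  pose a := index p (nb (g i)).
  have size_nb j : size (nb (g j)) = size (nb (g i)).
    by have := congr1 size (gprof j i); rewrite !size_map.
  have al j : a < size (nb (g j)) by rewrite size_nb index_mem nbE.
  pose y j := nth p (nb (g j)) a.
  have yE j : edge G (g j) (y j) by rewrite -nbE mem_nth.
  have injy : injective y.
    by move=> j k E; apply: (sep0 j k (y j)); rewrite ?E dist_le_edge ?yE // -E yE.
  (* In exchange for [g i], the vertex [p] gains the vertices in its own position at those [g j] for
     which [j] is adjacent to [i] in the regular graph. *)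
  have -> : deg H p = #|([set q | edge G p q] :\ g i) :|:
                        [set y j | j in [set j : 'I_N | circ N (dl p) i j]]|.
    congr #|pred_of_set _|; apply/setP => q; rewrite !inE /= /he (negbTE pX) /=.
    case: (boolP (q \in X)) => [/imsetP[j _ ->]|qX].
      have -> : FQ p (g j) = false.
        apply/existsP => -[i' /existsP[j' /and3P[/eqP E]]].
        by rewrite E inX in pX.
      symmetry; apply/negP => /orP[/andP[ne]|/imsetP[k _ E]].
        rewrite edge_sym => jp; case/eqP: ne; congr g.
        by apply: (sep0 _ _ p) => //; apply: dist_le_edge.
      by have := yE k; rewrite -E gg.
    have -> : q != g i by apply: contra qX => /eqP->.
    rewrite /=; congr (_ || _); apply/existsP/imsetP.
      case=> i' /existsP[j /and4P[i'p jq /eqP E c]].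
      have ii : i' = i by apply: (sep0 _ _ p) => //; apply: dist_le_edge.
      subst i'; exists j; first by rewrite inE.
      by rewrite /y /a E nth_index ?nbE.
    case=> j; rewrite inE => c qE; exists i; apply/existsP; exists j.
    rewrite ip qE yE c /y index_uniq ?al ?enum_uniq //; by rewrite eqxx.
  (* A vertex both kept and gained would be adjacent to [p] and to [g j], forcing [i = j] by [sep],
     whereas [circ] has no loops. *)
  rewrite cardsU [X in _ - X](_ : _ = 0) ?subn0; last first.
    apply/eqP; rewrite cards_eq0; apply/eqP/setP => q; rewrite !inE.
    apply/negP => /andP[/andP[_ pq] /imsetP[j]]; rewrite inE => c qE.
    have ij : i = j.
      apply: (sep _ _ p q) ip1 _ _; last by rewrite qE; apply: dist_le_edge.
      by apply: (@dist_leW _ _ 1); [lia|apply: dist_le_edge].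
    by move: c; rewrite ij circ_irr.
  have dp := dG p.
  rewrite (card_imset _ injy) card_circ //; last by rewrite /dl; lia.
  have := cardsD1 (g i) [set q | edge G p q]; rewrite inE edge_sym ip.
  move: d0 dp; rewrite /dl /deg; lia.
have same x : x \notin D -> edge H x =1 edge G x.
  move=> xD y; apply/eqP; apply: contraNT xD; rewrite eq_sym; exact: diff.
exists H; split=> //.
- apply/max_degreeP => x; case: (boolP (x \in X)) => [/imsetP[i _ ->]|xX].
    apply: leq_trans (elimT (max_degreeP _ _) dQ i).
    rewrite /deg -(card_imset _ injg); apply: subset_leq_card.
    apply/subsetP => y; rewrite inE => /gH[j -> e]; apply/imsetP; exists j => //.
    by rewrite inE.
  case: (boolP (x \in D)) => xD; first by rewrite degD.
  apply: leq_trans (dG x); rewrite /deg; apply: subset_leq_card.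
  by apply/subsetP => y; rewrite !inE same.
- apply: leq_trans (edit_dist_within diff) _; rewrite leq_exp2r //.
  apply: (@leq_trans (\sum_(i < N) d.+1)); last by rewrite sum_nat_const card_ord.
  apply: (@leq_trans (\sum_i #|g i |: [set y | edge G (g i) y]|)).
    rewrite /D; elim/big_rec2: _ => [|i m A _ le]; first by rewrite cards0.
    by apply: leq_trans (leq_card_setU _ _) _; rewrite leq_add2l.
  apply: leq_sum => i _; rewrite cardsU1; have := dG (g i); rewrite /deg.
  by case: (_ \notin _) => /=; lia.
- move=> w hw y; apply: same; apply/negP => /DP[i h _].
  by have := hw i; rewrite h.
- move=> z tz; case: (boolP (z \in X)) => [/imsetP[i _ ->]|zX].
    by right; exists i.
  left; suff [] : has_type tau G z /\ z \notin D by [].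
  apply: (surgery hr htau diff (X := X)) tz => //.
  + by move=> x xD xX; rewrite degD.
  + move=> x y xy; rewrite /= /he xy /=; case: ifP => // /orP[] /imsetP[i _ ->] _;
      [left|right] => w e; apply: inD; exact: dist_le_edge e.
  + move=> x y; rewrite /= /he => h n xX yX; move: h.
    rewrite (negbTE n) (negbTE xX) (negbTE yX) /=.
    case/existsP => i /existsP[j /and4P[ix jy _ c]]; apply/negP => xy.
    have ij : i = j by apply: (sep i j x y) xy _; apply: dist_le_edge.
    by move: c; rewrite ij circ_irr.
Qed.

(** Colouring vertices by the degrees of their neighbours takes boundedly many colours, so a large
    graph has a large colour class away from [v] and [u], and this class contains a family of [N]
    pairwise distant vertices. *)
Lemma insert : exists n0, forall (V : finType) (G : graph V) (v u : V),
  n0 <= #|V| -> max_degree G <= d ->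
  exists (H : graph V) (g : 'I_N -> V),
  [/\ max_degree H <= d, edit_dist G H <= (N * d.+1) ^ 2,
      [/\ injective g, (forall i, g i != v) & (forall i, g i != u)],
      (forall i y, edge H (g i) y <-> exists2 j, y = g j & edge Q i j) &
      [/\ edge H v =1 edge G v, edge H u =1 edge G u &
          forall z, has_type tau H z -> has_type tau G z \/ exists i, z = g i]].
Proof.
pose C := ('I_d.+1 * {ffun 'I_d -> 'I_d.+1})%type.
pose b := d.+1 ^ (1 + (r + r + 1)).
(* The last summand pays for the closed neighbourhoods of [v] and [u], which the family has to
   avoid. *)
exists (#|{: C}| * (N * b) + d.+1.*2) => V G v u nV dG.
have degG := elimT (max_degreeP G d) dG.
pose A := ~: (nbhd G 1 v :|: nbhd G 1 u).
have cA : #|{: C}| * (N * b) <= #|A|.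
  have := cardsC (nbhd G 1 v :|: nbhd G 1 u); rewrite -/A.
  have := card_nbhd 1 v dG; have := card_nbhd 1 u dG.
  have := leq_of_leqif (leq_card_setU (nbhd G 1 v) (nbhd G 1 u)).
  rewrite !expn1; lia.
pose dn x := [seq deg G y | y <- enum [set y | edge G x y]].
pose col x : C := (inord (size (dn x)), [ffun a : 'I_d => inord (nth 0 (dn x) a)]).
have C0 : 0 < #|{: C}| by apply/card_gt0P; exists (ord0, [ffun=> ord0]).
have [k hk] := pigeonhole col C0 cA.
have b0 : 0 < b by rewrite expn_gt0.
have [s [ss sA sp]] := far_family b0 (fun x => card_nbhd _ x dG) hk.
pose g (i : 'I_N) := nth v s i.
have gs i : g i \in s by rewrite mem_nth // ss.
have gA i : g i \in A by have := sA _ (gs i); rewrite inE => /andP[].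
have gcol i : col (g i) = k by have := sA _ (gs i); rewrite inE => /andP[_ /eqP].
have gfar i j : i != j -> ~~ dist_le G (1 + (r + r + 1)) (g i) (g j).
  have aux (x y : 'I_N) : x < y -> ~~ dist_le G (1 + (r + r + 1)) (g x) (g y).
    move=> xy; apply: (elimT (pairwiseP v) sp) => //; by rewrite inE ss.
  move=> /eqP ij; case: (ltngtP i j) => [/aux//|/aux|/val_inj//].
  by rewrite dist_le_sym.
have sdn x : size (dn x) = deg G x by rewrite size_map -cardE.
have gprof i j : dn (g i) = dn (g j).
  have := gcol i; rewrite -(gcol j) => -[E1 E2].
  have sE : size (dn (g i)) = size (dn (g j)).
    by move: (congr1 val E1); rewrite /= !inordK // ltnS sdn.
  apply: (@eq_from_nth _ 0) => // a ai.
  have ad : a < d by apply: leq_trans ai _; rewrite sdn.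
  have := congr1 (fun f : {ffun 'I_d -> 'I_d.+1} => val (f (Ordinal ad))) E2.
  rewrite /= !ffunE /=.
  by rewrite !inordK // ltnS (nth_map v) -?(size_map (deg G)) -?/(dn _) -?sE.
have [H [dH eH gH sH tH]] := insert_at_family dG gfar gprof.
have gv w : w = v \/ w = u -> forall i, ~~ dist_le G 1 (g i) w.
  move=> wE i; have := gA i; rewrite !inE negb_or dist_le_sym.
  by rewrite (dist_le_sym _ _ u) => /andP[]; case: wE => ->.
exists H, g; split=> //.
- split=> [i j E|i|i].
  + apply/eqP; apply: contraT => /gfar; by rewrite E dist_le_refl.
  + apply/eqP => E; have := gv v (or_introl erefl) i; by rewrite E dist_le_refl.
  + apply/eqP => E; have := gv u (or_intror erefl) i; by rewrite E dist_le_refl.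
- by split=> //; apply: sH; apply: gv; [left|right].
Qed.

End Insert.

(** * Removing all vertices of type tau *)

Lemma handshake n (G : graph 'I_n) : ~~ odd (\sum_v deg G v).
Proof.
have degE v : deg G v = \sum_w edge G v w.
  rewrite /deg -sum1_card big_mkcond /=; apply: eq_bigr => w _.
  by rewrite inE; case: edge.
pose e (v w : 'I_n) := if v < w then edge G v w : nat else 0.
have -> : \sum_v deg G v = (\sum_v \sum_w e v w) + \sum_v \sum_w e v w.
  rewrite [X in _ + X]exchange_big -big_split /=; apply: eq_bigr => v _.
  rewrite degE -big_split /=; apply: eq_bigr => w _; rewrite /e.
  case: (ltngtP v w) => [||/val_inj->]; rewrite ?addn0 ?add0n //.
    by rewrite edge_sym.
  by rewrite edge_irr.
by rewrite addnn odd_double.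
Qed.

Lemma odd_sum_even (I : finType) (F : I -> nat) v :
  (forall i, i != v -> ~~ odd (F i)) -> odd (\sum_i F i) = odd (F v).
Proof.
move=> h; rewrite (bigD1 v) //= oddD [X in _ (+) X](_ : _ = false) ?addbF //.
apply/negbTE; elim/big_rec: _ => // i m iv; rewrite oddD (negbTE (h i iv)).
by case: (odd m).
Qed.

Lemma card_ord_interval n a b :
  b <= n -> #|[set j : 'I_n | a <= j < b]| = b - a.
Proof.
rewrite (card_ordE (fun j => a <= j < b)).
suff -> : count (fun j => a <= j < b) (iota 0 n) = minn b n - a by lia.
elim: n => [|n IH]; first by rewrite /=; lia.
rewrite -addn1 iotaD count_cat IH /=; lia.
Qed.

(** * Components and disjoint unions *)

Section Components.

(** As [y] ranges over all of [V], no edge of [H] leaves the image of [g]: it is a union of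
    components of [H] forming a copy of [Q]. *)
Definition comp_emb (U V : finType) (Q : graph U) (H : graph V) (g : U -> V) :=
  injective g /\ forall i y, edge H (g i) y <-> exists2 j, y = g j & edge Q i j.

Lemma comp_emb_deg (U V : finType) (Q : graph U) (H : graph V) g i :
  comp_emb Q H g -> deg H (g i) = deg Q i.
Proof.
case=> injg gP; rewrite /deg -(card_imset _ injg); congr #|pred_of_set _|.
apply/setP => y; rewrite inE; apply/idP/imsetP => [/gP[j -> e]|[j]].
  by exists j; rewrite ?inE.
by rewrite inE => e ->; apply/gP; exists j.
Qed.

Variables (a b : nat) (A : graph 'I_a) (B : graph 'I_b).

Definition gsum_edge (x y : 'I_(a + b)) : bool :=
  match split x, split y with
  | inl i, inl j => edge A i j
  | inr i, inr j => edge B i j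
  | _, _ => false
  end.

Lemma gsum_sym : symmetric gsum_edge.
Proof.
by move=> x y; rewrite /gsum_edge; case: (split x) => i; case: (split y) => j //;
  rewrite edge_sym.
Qed.

Lemma gsum_irr : irreflexive gsum_edge.
Proof. by move=> x; rewrite /gsum_edge; case: (split x) => i; rewrite edge_irr. Qed.

Definition gsum : graph 'I_(a + b) := Graph gsum_sym gsum_irr.

Lemma gsum_lshift : comp_emb A gsum (@lshift a b).
Proof.
split=> [|i y]; first exact: lshift_inj.
rewrite /= /gsum_edge (unsplitK (inl i)).
split=> [|[j -> e]]; last by rewrite (unsplitK (inl j)).
by case: splitP => j yE // e; exists j => //; apply: val_inj.
Qed.

Lemma gsum_rshift : comp_emb B gsum (@rshift a b).
Proof.
split=> [|i y]; first exact: rshift_inj.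
rewrite /= /gsum_edge (unsplitK (inr i)).
split=> [|[j -> e]]; last by rewrite (unsplitK (inr j)).
by case: splitP => j yE // e; exists j => //; apply: val_inj.
Qed.

Lemma max_degree_gsum d :
  max_degree A <= d -> max_degree B <= d -> max_degree gsum <= d.
Proof.
move=> /max_degreeP dA /max_degreeP dB; apply/max_degreeP => x.
rewrite -[x]splitK; case: (split x) => i /=.
  by rewrite (comp_emb_deg _ gsum_lshift).
by rewrite (comp_emb_deg _ gsum_rshift).
Qed.

End Components.

Lemma comp_emb_comp (U V W : finType) (P : graph U) (Q : graph V) (H : graph W) f g :
  comp_emb P Q f -> comp_emb Q H g -> comp_emb P H (g \o f).
Proof.
move=> [injf fP] [injg gP]; split=> [|i y]; first exact: inj_comp.
split=> [/gP[j -> /fP[k -> e]]|[k -> e]]; first by exists k.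
by apply/gP; exists (f k) => //; apply/fP; exists k.
Qed.

Definition empty_graph (V : finType) : graph V :=
  @Graph V (fun _ _ => false) (fun _ _ => erefl) (fun _ => erefl).

Lemma max_degree_empty (V : finType) d : max_degree (empty_graph V) <= d.
Proof.
apply/max_degreeP => v; rewrite /deg.
have -> : [set w | edge (empty_graph V) v w] = set0 by apply/setP => w; rewrite !inE.
by rewrite cards0.
Qed.

Section Bipartite.
Variable d : nat.

Definition bip_edge (i j : 'I_d.*2) : bool := odd i != odd j.

Lemma bip_sym : symmetric bip_edge.
Proof. by move=> i j; rewrite /bip_edge eq_sym. Qed.

Lemma bip_irr : irreflexive bip_edge.
Proof. by move=> i; rewrite /bip_edge eqxx. Qed.

Definition bip : graph 'I_d.*2 := Graph bip_sym bip_irr.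

Lemma deg_bip i : deg bip i = d.
Proof.
rewrite -[RHS](card_ord_odd d (~~ odd i)); congr #|pred_of_set _|.
by apply/setP => j; rewrite !inE /= /bip_edge; lia.
Qed.

End Bipartite.

Section Removal.
Variables (r d' d : nat) (tau : rtype r).
Hypothesis hr : 1 <= r.
Hypothesis hd : d' < d.
Hypothesis htau : forall B : rooted, tau B -> max_degree (bgraph B) <= d'.

(** The vertices of the inserted [K_(d,d)] have degree [d > d'], so only the copy of [W] can
    contribute new vertices of type [tau]. *)
Lemma insert_bip w (W : graph 'I_w) :
  ~~ odd w -> max_degree W <= d -> exists c n0, forall n (G : graph 'I_n) v u,
  n0 <= n -> max_degree G <= d ->
  exists (H : graph 'I_n) f g, [/\ max_degree H <= d, edit_dist G H <= c,
    [/\ comp_emb (bip d) H f, comp_emb W H g, forall i j, g i != f j,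
        forall i, v != f i /\ u != f i & forall i, v != g i /\ u != g i],
    deg H v = deg G v /\ deg H u = deg G u &
    forall z, has_type tau H z -> has_type tau G z \/ exists i, z = g i].
Proof.
move=> ew dW; pose Q := gsum (bip d) W.
have dQ : max_degree Q <= d.
  by apply: max_degree_gsum => //; apply/max_degreeP => i; rewrite deg_bip.
have eN : ~~ odd (d.*2 + w) by rewrite oddD odd_double.
have [n0 n0P] := @insert r d' d tau hr hd htau _ Q eN (leq_addr _ _) dQ.
exists (((d.*2 + w) * d.+1) ^ 2), n0 => n G v u nn dG.
have [|H [g [dH eH [injg gv gu] gP [Hv Hu tH]]]] := n0P _ G v u _ dG.
  by rewrite card_ord.
have gQ : comp_emb Q H g by [].
have fP := comp_emb_comp (gsum_lshift _ _) gQ.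
exists H, (g \o @lshift _ w), (g \o @rshift d.*2 w); split=> //.
- split=> //; first exact: comp_emb_comp (gsum_rshift _ _) gQ.
  + by move=> i j; rewrite (inj_eq injg) eq_rlshift.
  + by move=> i; rewrite ![_ == (g \o _) _]eq_sym gv gu.
  + by move=> i; rewrite ![_ == (g \o _) _]eq_sym gv gu.
- by split; congr #|pred_of_set _|; apply/setP => y; rewrite !inE.
- move=> z tz; case: (tH z tz) => [|[i zE]]; first by left.
  right; move: zE; rewrite -[i]splitK; case: (split i) => j zE; last by exists j.
  have := has_type_deg hr htau tz (dist_le_refl _ _ _).
  by rewrite zE (comp_emb_deg _ fP) deg_bip leqNgt hd.
Qed.

Lemma kill1 n (G : graph 'I_n) f v :
  max_degree G <= d -> comp_emb (bip d) G f -> (forall i, v != f i) ->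
  ~~ odd (d - deg G v) -> deg G v < d ->
  exists H : graph 'I_n, [/\ max_degree H <= d, edit_dist G H <= d.*2.*2 ^ 2 &
    forall z, has_type tau H z -> has_type tau G z /\ z != v].
Proof.
move=> dG [injf fP] vf ev vd.
have [||i _|H [dH eH tH]] :=
  @kill r d' d tau hr hd htau _ G f (fun=> v) (d - deg G v) dG injf fP ev.
- by lia.
- by [].
- rewrite (_ : [set j : 'I__ | _] = [set j : 'I_d.*2 | 0 <= j < d - deg G v]).
    by rewrite card_ord_interval; lia.
  by apply/setP => j; rewrite !inE eqxx andbT.
exists H; split=> // z /tH[tz h]; split=> //; apply: (h 0); lia.
Qed.

(** The first [d - deg G v] stubs are [v] and the others are [u]; two odd deficiencies have an even
    sum. *)
Lemma kill2 n (G : graph 'I_n) f v u :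
  max_degree G <= d -> comp_emb (bip d) G f ->
  (forall i, v != f i /\ u != f i) -> v != u ->
  odd (d - deg G v) -> odd (d - deg G u) ->
  exists H : graph 'I_n, [/\ max_degree H <= d, edit_dist G H <= d.*2.*2 ^ 2 &
    forall z, has_type tau H z -> [/\ has_type tau G z, z != v & z != u]].
Proof.
move=> dG [injf fP] vuf vu ov ou.
pose m := d - deg G v; pose e := m + (d - deg G u).
pose stub i := if i < m then v else u.
have [||i j _|i ie|H [dH eH tH]] :=
  @kill r d' d tau hr hd htau _ G f stub e dG injf fP.
- by rewrite oddD ov ou.
- by rewrite /e /m; lia.
- by rewrite /stub; case: ifP; have [] := vuf j.
- rewrite /stub; case: ifP => im.
    rewrite (_ : [set j : 'I__ | _] = [set j : 'I_d.*2 | 0 <= j < m]).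
      by rewrite card_ord_interval /m; lia.
    apply/setP => j; rewrite !inE; case: ifP => jm; rewrite ?eqxx /=.
      by rewrite /e; lia.
    by rewrite eq_sym (negbTE vu) andbF.
  rewrite (_ : [set j : 'I__ | _] = [set j : 'I_d.*2 | m <= j < e]).
    by rewrite card_ord_interval /e /m; lia.
  apply/setP => j; rewrite !inE; case: ifP => jm; rewrite ?eqxx /=.
    by rewrite (negbTE vu) andbF; lia.
  by rewrite /e; lia.
exists H; split=> // z /tH[tz h]; split=> //.
  by have := h 0; rewrite /stub /e /m; case: ifP; lia.
by have := h m; rewrite /stub ltnn; apply; rewrite /e; lia.
Qed.

(* Without an odd tau-free graph, tau-freeness may be unsatisfiable on an odd
   number of vertices: take d = 1 and the type of an isolated vertex. *)
Definition parity_free :=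
  exists n (Q : graph 'I_n), [/\ odd n, max_degree Q <= d & nbhd_free tau Q].

Lemma step_const : exists c n0, forall n (G : graph 'I_n) v,
  n0 <= n -> ~~ odd (d * n) \/ parity_free -> max_degree G <= d ->
  has_type tau G v ->
  exists H : graph 'I_n, [/\ max_degree H <= d, edit_dist G H <= c &
    forall z, has_type tau H z -> has_type tau G z /\ z != v].
Proof.
have [c1 [n1 ins1]] := @insert_bip 0 (empty_graph _) isT (max_degree_empty _ _).
have [c2 [n2 ins2]] : exists c n0, forall n (G : graph 'I_n) v,
    n0 <= n -> parity_free -> max_degree G <= d -> odd d -> odd (d - deg G v) ->
    exists H : graph 'I_n, [/\ max_degree H <= d, edit_dist G H <= c &
      forall z, has_type tau H z -> has_type tau G z /\ z != v].
  (* The constants depend on [Q] and are fixed before [parity_free] is assumed, so its truth is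
     decided first; if it fails, any constants do. *)
  have [[nQ [Q [oQ dQ tQ]]]|no] := EM parity_free; last by exists 0, 0.
  pose W := gsum Q (empty_graph 'I_1).
  have dW : max_degree W <= d by apply: max_degree_gsum (max_degree_empty _ _).
  have eW : ~~ odd (nQ + 1) by rewrite oddD oQ.
  have [c [n0 ins]] := insert_bip eW dW.
  exists (c + d.*2.*2 ^ 2), n0 => n G v nn _ dG od ov.
  have [H [f [g [dH eH [fP gP gf vf vg] [dv _] tH]]]] := ins n G v v nn dG.
  (* The isolated vertex has deficiency [d], which is odd, and serves as the partner of [v]. *)
  pose u := g (rshift nQ ord0).
  have du : deg H u = 0.
    rewrite (comp_emb_deg _ gP) (comp_emb_deg _ (gsum_rshift _ _)).
    by apply/eqP; rewrite -leqn0; apply: (elimT (max_degreeP _ _));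
      apply: max_degree_empty.
  have vu : v != u by have [] := vg (rshift nQ ord0).
  have vuf i : v != f i /\ u != f i by have [-> _] := vf i; rewrite gf.
  have [||K [dK eK tK]] := kill2 dH fP vuf vu; rewrite ?dv ?du ?subn0 //.
  exists K; split=> //.
    by apply: leq_trans (edit_dist_trans G H K) _; apply: leq_add.
  move=> z /tK[tz zv zu]; split=> //.
  (* A new vertex of type [tau] would lie in the copy of the tau-free [Q] or be [u], which [kill2]
     has excluded. *)
  case: (tH z tz) => // -[i]; rewrite -[i]splitK; case: (split i) => j /= zE.
    have := comp_emb_comp (gsum_lshift _ _) gP => -[injg gP'].
    by rewrite zE in tz; have /tQ := has_type_component injg gP' tz.
  by case/eqP: zu; rewrite zE /u; congr (g _); congr rshift;
    apply: val_inj; case: j {zE} => -[].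
exists (c1 + c2 + d.*2.*2 ^ 2), (maxn n1 n2) => n G v; rewrite geq_max => /andP[nn1 nn2].
move=> par dG tv.
have vd : deg G v < d.
  by apply: leq_ltn_trans (has_type_deg hr htau tv (dist_le_refl _ _ _)) hd.
have [ov|ev] := boolP (odd (d - deg G v)); last first.
  have [H [f [g [dH eH [fP gP gf vf vg] [dv _] tH]]]] := ins1 n G v v nn1 dG.
  have [|||K [dK eK tK]] := kill1 dH fP (v := v); rewrite ?dv //.
    by move=> i; have [] := vf i.
  exists K; split=> //.
    apply: leq_trans (edit_dist_trans G H K) _; apply: leq_add => //.
    exact: leq_trans eH (leq_addr _ _).
  by move=> z /tK[/tH[tz|[[]//]] zv].
have [/existsP[u /andP[uv ou]]|] := boolP [exists u, (u != v) && odd (d - deg G u)].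
  have [H [f [g [dH eH [fP gP gf vf vg] [dv du] tH]]]] := ins1 n G v u nn1 dG.
  have [|||K [dK eK tK]] := kill2 dH fP vf; rewrite ?dv ?du 1?eq_sym //.
  exists K; split=> //.
    apply: leq_trans (edit_dist_trans G H K) _; apply: leq_add => //.
    exact: leq_trans eH (leq_addr _ _).
  by move=> z /tK[/tH[tz|[[]//]] zv _].
rewrite negb_exists => /forallP noodd.
(* Only [v] has odd deficiency, so the deficiencies have an odd sum; adding the even sum of the
   degrees gives [d * n]. *)
have odn : odd (d * n).
  have os : odd (\sum_(i < n) (d - deg G i)).
    by rewrite (@odd_sum_even _ _ v) // => i iv; have := noodd i; rewrite iv.
  have -> : d * n = \sum_(i < n) (d - deg G i) + \sum_(i < n) deg G i.
    rewrite -big_split /= -[n in LHS]card_ord mulnC -sum_nat_const.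
    apply: eq_bigr => i _; have := elimT (max_degreeP _ _) dG i; lia.
  by rewrite oddD (negbTE (handshake G)) addbF.
have [|pf] := par; first by rewrite odn.
have od : odd d by move: odn; rewrite oddM => /andP[].
have [K [dK eK tK]] := ins2 n G v nn2 pf dG od ov.
by exists K; split=> //; lia.
Qed.

Definition type_set n (G : graph 'I_n) : {set 'I_n} :=
  [set v | `[< has_type tau G v >]].

(** Each use of [step_const] costs at most [c] edits, destroys one vertex of type [tau] and creates
    none, which gives an induction on their number. *)
Lemma removal : exists c n0, forall n (G : graph 'I_n),
  n0 <= n -> ~~ odd (d * n) \/ parity_free -> max_degree G <= d ->
  exists H : graph 'I_n, [/\ max_degree H <= d, nbhd_free tau H &
    edit_dist G H <= c * #|type_set G|].
Proof.
have [c [n0 st]] := step_const; exists c, n0 => n G nn par.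
have [k] := ubnP #|type_set G|; elim: k G => // k IH G lek dG.
have [S0|[v]] := set_0Vmem (type_set G).
  exists G; split=> //; last by rewrite edit_dist_refl.
  move=> v tv; have : v \in type_set G by rewrite inE; apply/asboolP.
  by rewrite S0 inE.
rewrite inE => /asboolP tv.
have [H [dH eH tH]] := st n G v nn par dG tv.
have lt : #|type_set H| < #|type_set G|.
  apply: proper_card; apply/properP; split.
    by apply/subsetP => z; rewrite !inE => /asboolP/tH[tz _]; apply/asboolP.
  exists v; rewrite inE; first exact/asboolP.
  by apply/asboolP => /tH[_]; rewrite eqxx.
have [K [dK tK eK]] := IH H (leq_trans lt lek) dH.
exists K; split=> //; apply: leq_trans (edit_dist_trans G H K) _.
have : c * #|type_set H|.+1 <= c * #|type_set G| by rewrite leq_mul2l lt orbT.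
rewrite mulnS; lia.
Qed.

End Removal.

(** * The program *)

(** Nonzero means true, so that products act as conjunctions and sums as disjunctions. *)
Definition e_not (e : expr) : expr := Bin Eq e (Const 0).
Definition e_and : expr -> expr -> expr := Bin Mul.
Definition e_all T (s : seq T) (f : T -> expr) : expr :=
  foldr (fun x => e_and (f x)) (Const 1) s.
Definition e_has T (s : seq T) (f : T -> expr) : expr :=
  foldr (fun x => Bin Add (f x)) (Const 0) s.
Definition e_lit (b : bool) (e : expr) : expr := if b then e else e_not e.

Section Program.
Variables (r d : nat) (B : rooted).

(* The queries explore the d-ary tree of walks from a sampled vertex in heap
   order: the children of node a are d * a + 1, ..., d * a + d, node a is kept
   in cell a + 3, and it holds 0 if the walk does not exist and w + 1 if it ends
   in w. Cell 0 holds the verdict, cell 1 the bound on 1 / eps, and cell 2 the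
   number of remaining samples. *)
Fixpoint tree_size k : nat := if k is k'.+1 then d * tree_size k' + 1 else 1.

Definition node (a : nat) : expr := Cell (Const (a + 3)).

(* The address n is not a vertex, so that the query is answered by 0. *)
Definition node_vertex (a : nat) : expr :=
  Bin Add (Bin Defs.Sub (node a) (Const 1)) (Bin Mul Nvert (e_not (node a))).

Definition load_cmd (s : seq nat) : cmd :=
  foldr (fun c k => Seq (Query (Const (c.+1 + 3)) (node_vertex (c %/ d))
                               (Const (c %% d))) k) Skip s.

Definition e_adj (a b : nat) : expr :=
  e_has (iota 0 d) (fun i => Bin Eq (node (d * a + i).+1) (node b)).

(** Several nodes may hold the same vertex, so vertices are compared by the contents of nodes. The
    last conjunct expresses that the embedding covers the whole ball. *)
Definition e_emb (phi : {ffun bvertex B -> 'I_(tree_size r)}) : expr :=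
  e_and (e_all (enum (bvertex B)) (fun x => e_and (node (phi x))
    (e_all (enum (bvertex B)) (fun y =>
       e_and (e_lit (x == y) (Bin Eq (node (phi x)) (node (phi y))))
            (e_lit (edge (bgraph B) x y) (e_adj (phi x) (phi y)))))))
  (e_and (Bin Eq (node (phi (centre B))) (node 0))
  (e_all (iota 0 (tree_size r)) (fun a => Bin Add (e_not (node a))
    (e_has (enum (bvertex B)) (fun x => Bin Eq (node a) (node (phi x))))))).

(** The search over all [phi] is unrolled into one fixed expression, depending only on [r], [d] and
    [B]. *)
Definition e_type : expr :=
  e_has (enum {ffun bvertex B -> 'I_(tree_size r)}) e_emb.

Section Eval.
Variables (R : realType) (eps : R) (n : nat) (m : memory).
Local Notation ev e := (eval eps n m e).

Lemma eval_not e : (ev (e_not e) != 0) = (ev e == 0).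
Proof. by rewrite /= eqb0 negbK. Qed.

Lemma eval_and e1 e2 : (ev (e_and e1 e2) != 0) = (ev e1 != 0) && (ev e2 != 0).
Proof. by rewrite /= muln_eq0 negb_or. Qed.

Lemma eval_or e1 e2 : (ev (Bin Add e1 e2) != 0) = (ev e1 != 0) || (ev e2 != 0).
Proof. by rewrite /= addn_eq0 negb_and. Qed.

Lemma eval_eq e1 e2 : (ev (Bin Eq e1 e2) != 0) = (ev e1 == ev e2).
Proof. by rewrite /= eqb0 negbK. Qed.

Lemma eval_all T (s : seq T) f : (ev (e_all s f) != 0) = all (fun x => ev (f x) != 0) s.
Proof. by elim: s => //= x s IH; rewrite eval_and IH. Qed.

Lemma eval_has T (s : seq T) f : (ev (e_has s f) != 0) = has (fun x => ev (f x) != 0) s.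
Proof. by elim: s => //= x s IH; rewrite eval_or IH. Qed.

Lemma eval_lit b e : (ev (e_lit b e) != 0) = ((ev e != 0) == b).
Proof. by case: b; rewrite /e_lit ?eval_not //; case: eqP. Qed.

Lemma eval_node a : ev (node a) = m (a + 3).
Proof. by []. Qed.

Lemma eval_type : reflect (exists phi : {ffun bvertex B -> 'I_(tree_size r)},
  [/\ forall x, m (phi x + 3) != 0,
      forall x y, (m (phi x + 3) == m (phi y + 3)) = (x == y),
      forall x y, has (fun i => m ((d * phi x + i).+1 + 3) == m (phi y + 3))
                      (iota 0 d) = edge (bgraph B) x y,
      m (phi (centre B) + 3) = m 3
    & forall a, a < tree_size r -> m (a + 3) != 0 ->
        exists x, m (a + 3) = m (phi x + 3)]) (ev e_type != 0).
Proof.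
have adj a b : (ev (e_adj a b) != 0) =
    has (fun i => m ((d * a + i).+1 + 3) == m (b + 3)) (iota 0 d).
  by rewrite /e_adj eval_has; apply: eq_has => i; rewrite eval_eq.
apply: (iffP idP); rewrite /e_type eval_has.
  case/hasP => phi _; rewrite /e_emb !eval_and eval_eq !eval_all !eval_node.
  case/and3P => /allP h1 /eqP h2 /allP h3; exists phi.
  have h x y : [/\ m (phi x + 3) != 0,
      (m (phi x + 3) == m (phi y + 3)) = (x == y) &
      has (fun i => m ((d * phi x + i).+1 + 3) == m (phi y + 3)) (iota 0 d) =
        edge (bgraph B) x y].
    have := h1 x (mem_enum _ _); rewrite eval_and eval_all.
    case/andP => nz /allP/(_ y (mem_enum _ _)).
    rewrite eval_and !eval_lit eval_eq adj !eval_node.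
    by case/andP => /eqP-> /eqP->.
  split=> //.
  - by move=> x; case: (h x x).
  - by move=> x y; case: (h x y).
  - by move=> x y; case: (h x y).
  move=> a aM; have := h3 a; rewrite mem_iota aM => /(_ isT).
  rewrite eval_or eval_not eval_has eval_node => /orP[->//|/hasP[x _]].
  by rewrite eval_eq => /eqP E _; exists x.
case=> phi [h1 h2 h3 h4 h5]; apply/hasP; exists phi; first exact: mem_enum.
rewrite /e_emb !eval_and eval_eq !eval_all !eval_node; apply/and3P; split.
- apply/allP => x _; rewrite eval_and eval_all !eval_node h1 /=; apply/allP => y _.
  by rewrite eval_and !eval_lit eval_eq adj !eval_node h2 h3 !eqxx.
- by rewrite h4.
- apply/allP => a; rewrite mem_iota add0n => /andP[_ aM].
  rewrite eval_or eval_not eval_has eval_node.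
  have [//|a0] := boolP (m (a + 3) == 0); have [x E] := h5 a aM a0.
  by apply/hasP; exists x; rewrite ?mem_enum // eval_eq !eval_node E.
Qed.

End Eval.

Section Tree.
Variables (n : nat) (G : graph 'I_n) (adj : 'I_n -> seq 'I_n).
Hypothesis dG : max_degree G <= d.
Hypothesis hadj : adj_lists G adj.

Definition child (x i : nat) : nat := if x is u.+1 then oracle d adj u i else 0.

(** The degree bound keeps adjacency lists within length [d], so the cut-off at index [d] hides no
    neighbour. *)
Lemma oracle_edge (u w : 'I_n) :
  edge G u w <-> exists2 i, i < d & oracle d adj u i = w.+1.
Proof.
have [uadj adj_u] := hadj u.
have sadj : size (adj u) <= d.
  apply: leq_trans (elimT (max_degreeP _ _) dG u).
  rewrite -(card_uniqP uadj); apply: subset_leq_card; apply/subsetP => y.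
  by rewrite inE adj_u.
rewrite /oracle valK; split=> [uw|[i id]].
  have wi : w \in adj u by rewrite adj_u.
  exists (index w (adj u)); first by rewrite (leq_trans _ sadj) // index_mem.
  rewrite (leq_trans _ sadj) ?index_mem // (nth_map w) ?index_mem //.
  by rewrite nth_index.
rewrite id; have [lt|ge] := ltnP i (size (adj u)); last first.
  by rewrite nth_default // size_map.
rewrite (nth_map w) // => -[/val_inj E]; have := mem_nth w lt.
by rewrite E adj_u.
Qed.

Lemma oracle_vertex (u : 'I_n) i :
  oracle d adj u i != 0 -> exists w : 'I_n, oracle d adj u i = w.+1.
Proof.
rewrite /oracle valK; case: ifP => // _.
have [lt|ge] := ltnP i (size (adj u)); last by rewrite nth_default // size_map.
by rewrite (nth_map u) //; exists (nth u (adj u) i).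
Qed.

Variables (v : 'I_n) (m : memory).
Hypothesis root_v : m 3 = v.+1.
Hypothesis tree_m : forall c, c < d * tree_size r ->
  m (c.+1 + 3) = child (m (c %/ d + 3)) (c %% d).

Lemma tree_child a i : a < tree_size r -> i < d ->
  m ((d * a + i).+1 + 3) = child (m (a + 3)) i.
Proof.
move=> ar id; rewrite tree_m; last first.
  apply: (@leq_trans (d * a.+1)); last by rewrite leq_mul2l ar orbT.
  by rewrite mulnS addnC ltn_add2r.
have d0 : 0 < d by lia.
by rewrite mulnC divnMDl // divn_small // addn0 modnMDl modn_small.
Qed.

Lemma tree_size_mono j k : j <= k -> tree_size j <= tree_size k.
Proof.
move=> /subnK <-; elim: (k - j) => // i IH; rewrite addSn.
apply: leq_trans IH _ => /=; case: (posnP d) => [d0|]; last by nia.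
by case: (i + j) => [|l] /=; rewrite d0 !mul0n.
Qed.

(** In heap order the children of the first [tree_size k] nodes are the nodes from 1 to
    [d * tree_size k]; with the root they make up the first [tree_size k.+1] nodes. *)
Lemma tree_reach k (w : 'I_n) : k <= r ->
  dist_le G k v w <-> exists2 a, a < tree_size k & m (a + 3) = w.+1.
Proof.
elim: k w => [|k IH] w kr.
  rewrite dist_le0; split=> [/eqP<-|[[|//] _]]; first by exists 0.
  by rewrite add0n root_v => -[/val_inj->].
have kr' : k <= r by lia.
have sr := tree_size_mono kr'.
split=> [/dist_leSP[z /(IH _ kr')[a ak az]]|[[|c] ck cw]].
- case/orP=> [/eqP<-|/oracle_edge[i id iw]].
    by exists a => //; apply: leq_trans ak (tree_size_mono _).
  exists (d * a + i).+1; last first.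
    by rewrite tree_child ?az //; apply: leq_trans ak sr.
  rewrite /= addn1 ltnS; apply: (@leq_trans (d * a.+1)).
    by rewrite mulnS addnC ltn_add2r.
  by rewrite leq_mul2l ak orbT.
- move: cw; rewrite add0n root_v => -[/val_inj<-]; exact: dist_le_refl.
- rewrite /= addn1 ltnS in ck; have d0 : 0 < d by lia.
  have ck' : c %/ d < tree_size k by rewrite ltn_divLR // mulnC.
  move: cw; rewrite tree_m; last first.
    by apply: leq_trans ck _; rewrite leq_mul2l sr orbT.
  rewrite /child; case E: (m _) => [//|u] cw.
  have un : u < n.
    by move: cw; rewrite /oracle; case: insubP => // u' ? <- _.
  apply/dist_leSP; exists (Ordinal un).
    by apply/(IH _ kr'); exists (c %/ d).
  by apply/orP; right; apply/oracle_edge; exists (c %% d); rewrite ?ltn_mod.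
Qed.

Lemma tree_vertex a : a < tree_size r -> m (a + 3) != 0 ->
  exists w : 'I_n, m (a + 3) = w.+1.
Proof.
case: a => [|c] ar; first by exists v.
have [k [kr ck]] : exists k, k < r /\ c < d * tree_size k.
  move: ar; case: (r) => [|k] //=; rewrite addn1 ltnS => ck; by exists k.
rewrite tree_m; last first.
  by apply: leq_trans ck _; rewrite leq_mul2l tree_size_mono ?orbT // ltnW.
rewrite /child; case: (m _) => // u nz.
have un : u < n by move: nz; rewrite /oracle; case: insubP => // u' ? <-.
exact: (@oracle_vertex (Ordinal un)).
Qed.

Lemma e_type_correct (R : realType) (eps : R) :
  eval eps n m e_type != 0 <-> exists f, @ball_emb r B _ G v f.
Proof.
split=> [/eval_type[phi [h1 h2 h3 h4 h5]]|[f [injf ef cf imf]]].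
  have ph x : exists w : 'I_n, m (phi x + 3) == w.+1.
    by have [w E] := tree_vertex (ltn_ord (phi x)) (h1 x); exists w; apply/eqP.
  pose f x := xchoose (ph x).
  have fE x : m (phi x + 3) = (f x).+1 by apply/eqP/(xchooseP (ph x)).
  exists f; split.
  - by move=> x y E; apply/eqP; rewrite -h2 !fE E.
  - move=> x y; rewrite -h3; apply/idP/hasP => [/oracle_edge[i id E]|[i]].
      exists i; first by rewrite mem_iota.
      by rewrite tree_child // !fE /= E.
    rewrite mem_iota => /= id; rewrite tree_child // !fE => /eqP E.
    by apply/oracle_edge; exists i.
  - by apply: val_inj; apply: succn_inj; rewrite -fE h4 root_v.
  - move=> w; split=> [/(tree_reach _ (leqnn r))[a ar aw]|[x <-]].
      have [|x E] := h5 a ar; first by rewrite aw.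
      by exists x; apply: val_inj; apply: succn_inj; rewrite -fE -E.
    by apply/(tree_reach _ (leqnn r)); exists (phi x).
have ph x : exists a : 'I_(tree_size r), m (a + 3) == (f x).+1.
  have /(tree_reach _ (leqnn r))[a ar E] : dist_le G r v (f x) by apply/imf; exists x.
  by exists (Ordinal ar); rewrite E.
pose phi : {ffun bvertex B -> 'I_(tree_size r)} := [ffun x => xchoose (ph x)].
have fE x : m (phi x + 3) = (f x).+1.
  by rewrite ffunE; apply/eqP/(xchooseP (ph x)).
apply/eval_type; exists phi; split.
- by move=> x; rewrite fE.
- by move=> x y; rewrite !fE eqSS val_eqE (inj_eq injf).
- move=> x y; rewrite -ef; apply/hasP/idP => [[i]|/oracle_edge[i id E]].
    rewrite mem_iota => /= id; rewrite tree_child // !fE => /eqP E.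
    by apply/oracle_edge; exists i.
  exists i; first by rewrite mem_iota.
  by rewrite tree_child // !fE /= E.
- by rewrite fE cf root_v.
move=> a ar nz; have [w E] := tree_vertex ar nz.
have /imf[x xw] : dist_le G r v w by apply/(tree_reach _ (leqnn r)); exists a.
by exists x; rewrite fE E xw.
Qed.

End Tree.
End Program.

(** * Probabilities *)

Section Runs.
Variables (R : realType) (eps : R) (n d : nat) (adj : 'I_n -> seq 'I_n).
Local Notation prob := (prob eps d adj).
Local Notation halts := (halts_within eps d adj).
Local Notation eval := (eval eps n).

Lemma prob_step1 b t x k m c' : step eps d adj (x :: k, m) = [:: c'] ->
  prob b t.+1 (x :: k, m) = prob b t c'.
Proof.
move=> E.
have -> : prob b t.+1 (x :: k, m) =
    ((\sum_(c0 <- step eps d adj (x :: k, m)) prob b t c0) /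
     (size (step eps d adj (x :: k, m)))%:R)%R by [].
by rewrite E big_seq1 divr1.
Qed.

Lemma halts_step1 t x k m c' : step eps d adj (x :: k, m) = [:: c'] ->
  halts t.+1 (x :: k, m) = halts t c'.
Proof.
move=> E.
have -> : halts t.+1 (x :: k, m) = all (halts t) (step eps d adj (x :: k, m)) by [].
by rewrite E all_seq1.
Qed.

(** Deterministic progress, phrased by its effect on [prob] and [halts_within] for every remaining
    time, so that runs can be chained. *)
Definition leads (t : nat) (c c' : config) : Prop :=
  forall t', (forall b, prob b (t + t') c = prob b t' c') /\
    halts (t + t') c = halts t' c'.

Lemma leads_trans t1 t2 c1 c2 c3 :
  leads t1 c1 c2 -> leads t2 c2 c3 -> leads (t1 + t2) c1 c3.
Proof.
move=> h1 h2 t'; have [p1 q1] := h1 (t2 + t'); have [p2 q2] := h2 t'.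
by rewrite -addnA; split=> [b|]; rewrite ?p1 ?q1.
Qed.

Lemma leads1 x k m c' : step eps d adj (x :: k, m) = [:: c'] ->
  leads 1 (x :: k, m) c'.
Proof.
by move=> h t'; rewrite add1n; split=> [b|]; [apply: prob_step1|apply: halts_step1].
Qed.

Definition runs (c : cmd) (t : nat) (m m' : memory) : Prop :=
  forall k, leads t (c :: k, m) (k, m').

Lemma runs_step c m m' :
  (forall k, step eps d adj (c :: k, m) = [:: (k, m')]) -> runs c 1 m m'.
Proof. by move=> h k; apply: leads1. Qed.

Lemma runs_skip m : runs Skip 1 m m.
Proof. exact: runs_step. Qed.

Lemma runs_store a e m : runs (Store a e) 1 m (update m (eval m a) (eval m e)).
Proof. exact: runs_step. Qed.

Lemma runs_query a v i m : runs (Query a v i) 1 m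
  (update m (eval m a) (oracle d adj (eval m v) (eval m i))).
Proof. exact: runs_step. Qed.

Lemma runs_seq c1 c2 t1 t2 m1 m2 m3 : runs c1 t1 m1 m2 -> runs c2 t2 m2 m3 ->
  runs (Seq c1 c2) (t1 + t2).+1 m1 m3.
Proof.
move=> h1 h2 k; rewrite -add1n.
apply: (leads_trans (c2 := (c1 :: c2 :: k, m1))); first exact: leads1.
exact: leads_trans (h1 _) (h2 k).
Qed.

Lemma runs_if e c1 c2 t m m' :
  runs (if eval m e != 0 then c1 else c2) t m m' -> runs (If e c1 c2) t.+1 m m'.
Proof.
move=> h k; rewrite -add1n.
apply: (leads_trans (c2 := ((if eval m e != 0 then c1 else c2) :: k, m))) (h k).
exact: leads1.
Qed.

Lemma runs_while_stop e c m : eval m e == 0 -> runs (While e c) 1 m m.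
Proof. by move=> h; apply: runs_step => k; rewrite /= h. Qed.

Lemma runs_while_step e c t1 t2 m1 m2 m3 : eval m1 e != 0 ->
  runs c t1 m1 m2 -> runs (While e c) t2 m2 m3 ->
  runs (While e c) (t1 + t2).+1 m1 m3.
Proof.
move=> h h1 h2 k; rewrite -add1n.
apply: (leads_trans (c2 := (c :: While e c :: k, m1))).
  by apply: leads1; rewrite /= h.
exact: leads_trans (h1 _) (h2 k).
Qed.

Lemma prob_rand b t a k m : 0 < n ->
  prob b t.+1 (Rand (Const a) Nvert :: k, m) =
  ((\sum_(x < n) prob b t (k, update m a x)) / n%:R)%R.
Proof.
move=> n0; rewrite [LHS]/= size_map size_iota (maxn_idPr n0) big_map.
by congr (_ / _)%R; rewrite -(big_mkord xpredT (fun j => prob b t (k, update m a j)))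
  /index_iota subn0.
Qed.

Fixpoint loadm (m : memory) (l : nat) : memory :=
  if l is l'.+1 then
    let m' := loadm m l' in
    update m' (l + 3) (child d adj (m' (l' %/ d + 3)) (l' %% d))
  else m.

Lemma runs_load m s l :
  runs (load_cmd d (iota s l)) l.*2.+1 (loadm m s) (loadm m (s + l)).
Proof.
elim: l s => [|l IH] s; first by rewrite addn0; apply: runs_skip.
rewrite addnS -addSn (_ : l.+1.*2.+1 = (1 + l.*2.+1).+1) //.
apply: runs_seq (IH s.+1); rewrite [loadm m s.+1]/=.
set m' := loadm m s; rewrite (_ : child d adj _ _ =
  oracle d adj (eval m' (node_vertex (s %/ d))) (s %% d)); first exact: runs_query.
rewrite /=; case: (m' _) => [|u] /=; last by rewrite muln0 addn0 subn1.
by rewrite muln1 add0n /oracle insubN // ltnn.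
Qed.

Lemma loadm_low m l a : a <= 3 -> loadm m l a = m a.
Proof.
move=> a3; elim: l => //= l IH; rewrite /update IH; case: eqP => //; lia.
Qed.

(** The parent [c %/ d] is at most [c], so its cell is filled before that of node [c.+1], and later
    queries write to other cells. *)
Lemma loadm_tree m l c : c < l ->
  loadm m l (c.+1 + 3) = child d adj (loadm m l (c %/ d + 3)) (c %% d).
Proof.
elim: l => // l IH; rewrite ltnS leq_eqVlt => cl /=; rewrite /update.
have cd : c %/ d <= c by apply: leq_div.
have -> : (c %/ d + 3 == l.+1 + 3) = false by case/orP: cl => [/eqP|]; lia.
case/orP: cl => [/eqP<-|cl]; first by rewrite eqxx.
have -> : (c.+1 + 3 == l.+1 + 3) = false by lia.
exact: IH.
Qed.

(** Counts up in cell 1 to the least [q] with [1 <= eps * q], since [eps] is accessible through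
    comparisons only. *)
Definition qloop : cmd :=
  While (e_not (LeEps (Const 1) (Cell (Const 1))))
        (Store (Const 1) (Bin Add (Cell (Const 1)) (Const 1))).

Lemma runs_qloop q m : (1 <= eps * q%:R)%R ->
  (forall j, (1 <= eps * j%:R)%R -> q <= j) -> m 1 = 0 ->
  exists m', [/\ runs qloop q.*2.+1 m m', m' 1 = q & m' 0 = m 0].
Proof.
move=> hq minq m1.
suff h j m0 : m0 1 + j = q ->
    exists m', [/\ runs qloop j.*2.+1 m0 m', m' 1 = q & m' 0 = m0 0].
  by apply: h; rewrite m1.
elim: j m0 => [|j IH] m0.
  rewrite addn0 => m0q; exists m0; split=> //; apply: runs_while_stop.
  by rewrite /= m0q hq.
move=> m0q; have [|m' [rm' m'1 m'0]] := IH (update m0 1 (m0 1 + 1)).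
  by rewrite /update /=; lia.
exists m'; split=> //; rewrite (_ : j.+1.*2.+1 = (1 + j.*2.+1).+1) //.
apply: runs_while_step rm'; last exact: runs_store.
rewrite /= eqb0 negbK eqb0; apply/negP => /minq; lia.
Qed.

End Runs.

(** * The tester and its acceptance probability *)

Section Tester.
Variables (r d : nat) (B : rooted).

Definition tree_cells : nat := d * tree_size d r.

(** Adding 1 to the sample in cell 3 gives the oracle's encoding of a vertex, as the root of the
    tree. Cell 0 is only ever reset to 0, so one hit suffices for rejection. *)
Definition check_cmd : cmd :=
  Seq (Store (Const 3) (Bin Add (Cell (Const 3)) (Const 1)))
  (Seq (load_cmd d (iota 0 tree_cells))
  (Seq (If (e_type r d B) (Store (Const 0) (Const 0)) Skip)
       (Store (Const 2) (Bin Defs.Sub (Cell (Const 2)) (Const 1))))).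

Definition check_time : nat := tree_cells.*2 + 8.

Definition body : cmd := Seq (Rand (Const 3) Nvert) check_cmd.

(** The flag [bad] stands for the case where no graph of odd order is tau-free: for odd [n] the
    [Skip] then leaves 0 in cell 0, a rejection. The empty graph is accepted. *)
Definition tester (bad : bool) (c : nat) : cmd :=
  If (e_not Nvert) (Store (Const 0) (Const 1))
  (If (e_and (Const bad) (Bin Mod Nvert (Const 2))) Skip
  (Seq (Store (Const 0) (Const 1))
  (Seq qloop
  (Seq (Store (Const 2) (Bin Mul (Const c) (Cell (Const 1))))
       (While (Cell (Const 2)) body))))).

Definition tester_time (c q : nat) : nat := 10 + q.*2 + (c * q) * check_time.+3.

Variables (R : realType) (eps : R) (n : nat) (G : graph 'I_n).
Variable adj : 'I_n -> seq 'I_n.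
Variables (tau : rtype r).
Hypothesis dG : max_degree G <= d.
Hypothesis hadj : adj_lists G adj.
Hypothesis n0 : 0 < n.
Hypothesis tauB : forall v, has_type tau G v <-> exists f, @ball_emb r B _ G v f.
Local Notation prob := (prob eps d adj).
Local Notation halts := (halts_within eps d adj).
Local Notation S := (type_set tau G).

Lemma runs_check (m : memory) (x : 'I_n) : m 3 = x ->
  exists m', [/\ runs eps d adj check_cmd check_time m m', m' 2 = m 2 - 1 &
                 m' 0 = if x \in S then 0 else m 0].
Proof.
move=> m3; pose m1 := update m 3 (m 3 + 1); pose m2 := loadm d adj m1 tree_cells.
have low a : a < 3 -> m2 a = m a.
  move=> a3; rewrite /m2 loadm_low ?(ltnW a3) // /m1 /update.
  by case: eqP => // E; rewrite E in a3.
have m23 : m2 3 = x.+1 by rewrite /m2 loadm_low // /m1 /update eqxx m3 addn1.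
have tm2 c : c < tree_cells -> m2 (c.+1 + 3) = child d adj (m2 (c %/ d + 3)) (c %% d).
  exact: loadm_tree.
have chk : (eval eps n m2 (e_type r d B) != 0) = (x \in S).
  have tc := @e_type_correct r d B n G adj dG hadj x m2 m23 tm2 R eps.
  by rewrite inE; apply/idP/asboolP => [/tc/tauB//|h]; apply/tc/tauB.
pose m3' := if x \in S then update m2 0 0 else m2.
exists (update m3' 2 (m3' 2 - 1)); split.
- rewrite /check_time (_ : _ + 8 = (1 + (tree_cells.*2.+1 + (2 + 1).+1).+1).+1);
    last by lia.
  apply: runs_seq; first exact: runs_store.
  apply: runs_seq; first exact: (@runs_load R eps n d adj m1 0 tree_cells).
  apply: (runs_seq (m2 := m3')); last exact: runs_store.
  apply: runs_if; rewrite chk /m3'; case: (x \in S); first exact: runs_store.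
  exact: runs_skip.
- by rewrite /update eqxx /m3'; case: (x \in S); rewrite /update /= low.
- by rewrite /update /= /m3'; case: (x \in S); rewrite /update //= low.
Qed.

Lemma prob_body m : exists mx : 'I_n -> memory,
  [/\ forall x, mx x 2 = m 2 - 1,
      forall x, mx x 0 = if x \in S then 0 else m 0,
      forall k t b, prob b (check_time.+2 + t) (body :: k, m) =
        ((\sum_x prob b t (k, mx x)) / n%:R)%R
    & forall k t, (forall x, halts t (k, mx x)) ->
        halts (check_time.+2 + t) (body :: k, m)].
Proof.
have h x : {m' | [/\ runs eps d adj check_cmd check_time (update m 3 (x : 'I_n)) m',
    m' 2 = m 2 - 1 & m' 0 = if x \in S then 0 else m 0]}.
  apply: cid; have [m' [h1 h2 h3]] := @runs_check (update m 3 x) x erefl.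
  by exists m'.
exists (fun x => sval (h x)); split.
- by move=> x; case: (svalP (h x)).
- by move=> x; case: (svalP (h x)).
- move=> k t b; rewrite !addSn.
  rewrite (prob_step1 _ _ (c' := (Rand (Const 3) Nvert :: check_cmd :: k, m))) //.
  rewrite prob_rand //; congr (_ / _)%R; apply: eq_bigr => x _.
  by have [rx _ _] := svalP (h x); have [-> _] := rx k t.
- move=> k t hx; rewrite !addSn.
  rewrite (halts_step1 _ (c' := (Rand (Const 3) Nvert :: check_cmd :: k, m))) //.
  rewrite /= all_map; apply/allP => y; rewrite mem_iota (maxn_idPr n0) /= => yn.
  have [rx _ _] := svalP (h (Ordinal yn)); have [_ /= ->] := rx k t.
  exact: (hx (Ordinal yn)).
Qed.

Local Open Scope ring_scope.

Definition density : R := #|S|%:R / n%:R.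

(** Once cell 0 is 0 it remains so; otherwise the [j] samples independently miss type [tau] with
    probability [1 - density] each. *)
Lemma prob_loop b j m t : m 2%N = j ->
  prob b (j * check_time.+3 + 1 + t)%N ([:: While (Cell (Const 2)) body], m) =
  if m 0%N == 0%N then (b == false)%:R
  else if b then (1 - density) ^+ j else 1 - (1 - density) ^+ j.
Proof.
have nR : n%:R != 0 :> R by rewrite pnatr_eq0 -lt0n.
elim: j m => [|j IH] m mj.
  rewrite mul0n add0n add1n.
  rewrite (prob_step1 _ _ (c' := ([::], m))); last by rewrite /= mj.
  rewrite (_ : prob b t ([::], m) = (verdict ([::], m) == b)%:R); last by case: t.
  by rewrite /verdict /= expr0 subrr; case: (m 0%N == 0%N); case: b.
rewrite mulSn -!addnA addSn.
rewrite (prob_step1 _ _ (c' := ([:: body; While (Cell (Const 2)) body], m))); last first.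
  by rewrite /= mj.
have [mx [mx2 mx0 pmx _]] := prob_body m.
rewrite pmx (eq_bigr (fun x => if x \in S then (b == false)%:R else
  if m 0%N == 0%N then (b == false)%:R
  else if b then (1 - density) ^+ j else 1 - (1 - density) ^+ j)); last first.
  move=> x _; rewrite addnA IH; last by rewrite mx2 mj subn1.
  by rewrite mx0; case: (x \in S).
set z := (if m 0%N == 0%N then _ else _).
have -> : \sum_x (if x \in S then (b == false)%:R else z) =
    #|S|%:R * (b == false)%:R + (n%:R - #|S|%:R) * z :> R.
  rewrite (bigID (mem S)) /=; congr (_ + _).
    rewrite (eq_bigr (fun=> (b == false)%:R)); last by move=> x ->.
    by rewrite sumr_const -[LHS]mulr_natl.
  rewrite (eq_bigr (fun=> z)); last by move=> x /negbTE->.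
  rewrite (eq_bigl (mem (~: S))); last by move=> x; rewrite !inE.
  rewrite sumr_const -[LHS]mulr_natl; congr (_ * _).
  have := congr1 (fun i => i%:R : R) (cardsC S); rewrite card_ord natrD => <-.
  by rewrite addrC addKr.
rewrite /z; case: ifP => _.
  by rewrite -mulrDl addrC subrK mulrAC divff // mul1r.
rewrite exprS /density; case: b {IH pmx z} => /=; by field.
Qed.

Lemma halts_loop j m t : m 2%N = j ->
  halts (j * check_time.+3 + 1 + t)%N ([:: While (Cell (Const 2)) body], m).
Proof.
elim: j m => [|j IH] m mj.
  rewrite mul0n add0n add1n.
  rewrite (halts_step1 _ (c' := ([::], m))); last by rewrite /= mj.
  by case: t.
rewrite mulSn -!addnA addSn.
rewrite (halts_step1 _ (c' := ([:: body; While (Cell (Const 2)) body], m))); last first.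
  by rewrite /= mj.
have [mx [mx2 _ _ hmx]] := prob_body m.
by apply: hmx => x; rewrite addnA; apply: IH; rewrite mx2 mj subn1.
Qed.

Lemma tester_main bad c q : 1 <= eps * q%:R ->
  (forall j, 1 <= eps * j%:R -> (q <= j)%N) -> ~~ (bad && odd n) ->
  halts (tester_time c q) (start (tester bad c)) /\
  forall b, prob b (tester_time c q) (start (tester bad c)) =
    if b then (1 - density) ^+ (c * q) else 1 - (1 - density) ^+ (c * q).
Proof.
move=> hq minq nbad.
have [m [rm m1 m0]] := @runs_qloop R eps n d adj q (update (fun=> 0%N) 0 1) hq minq erefl.
pose m' := update m 2 (c * q).
have E : leads eps d adj (8 + q.*2) (start (tester bad c))
    ([:: While (Cell (Const 2)) body], m').
  set W := While _ _; rewrite /start /tester -/W.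
  rewrite (_ : 8 + q.*2 = 1 + (1 + (1 + (1 + (1 + (q.*2.+1 + (1 + 1)))))))%N; last by lia.
  apply: leads_trans; first exact: leads1.
  rewrite (eval_not eps n _ Nvert) (negbTE (lt0n_neq0 n0)).
  apply: leads_trans; first exact: leads1.
  have -> : (eval eps n (fun=> 0%N) (e_and (Const bad) (Bin Mod Nvert (Const 2))) != 0%N)
      = false.
    by rewrite eval_and /= modn2 !eqb0 !negbK; apply: negbTE.
  apply: leads_trans; first exact: leads1.
  apply: leads_trans; first exact: leads1.
  apply: leads_trans; first exact: leads1.
  apply: leads_trans; first exact: rm.
  apply: leads_trans; first exact: leads1.
  by apply: leads1; rewrite /= m1.
have [p h] := E (c * q * check_time.+3 + 1 + 1)%N.
rewrite /tester_time (_ : 10 + q.*2 + c * q * check_time.+3 =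
  8 + q.*2 + (c * q * check_time.+3 + 1 + 1))%N; last by lia.
have m'2 : m' 2 = (c * q)%N by [].
have m'0 : m' 0%N = 1%N by rewrite /m' /update /= m0.
split; first by rewrite h halts_loop.
by move=> b; rewrite p prob_loop // m'0.
Qed.
End Tester.

(** * Numerical bounds for the number of samples *)

Section Bounds.
Local Open Scope ring_scope.
Variable R : realType.

(** Since [(1 - p)(1 + (t + 1) p) <= 1 + t p], induction gives [(1 - p)^t (1 + t p) <= 1], where the
    second factor is at least 3 once [t p >= 2]. *)
Lemma miss_prob_le (p : R) t : 0 <= p <= 1 -> 2 <= t%:R * p ->
  (1 - p) ^+ t <= 1 / 3.
Proof.
move=> /andP[p0 p1] tp.
have q0 : 0 <= 1 - p by lra.
have : (1 - p) ^+ t * (1 + t%:R * p) <= 1.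
  elim: t {tp} => [|t IH]; first by rewrite expr0 mul0r addr0 mulr1.
  apply: le_trans IH; rewrite exprSr -mulrA ler_wpM2l ?exprn_ge0 //.
  rewrite -natr1; have t0 : 0 <= t%:R :> R by rewrite ler0n.
  have : 0 <= t%:R * p * p by rewrite !mulr_ge0.
  have : 0 <= p * p by rewrite mulr_ge0.
  lra.
have : 0 <= (1 - p) ^+ t by rewrite exprn_ge0.
move: ((1 - p) ^+ t) => x x0 h.
have : x * 3 <= x * (1 + t%:R * p) by rewrite ler_wpM2l //; lra.
lra.
Qed.

Lemma ex_inverse_bound (eps : R) : {q : nat | 0 < eps ->
  1 <= eps * q%:R /\ forall j : nat, 1 <= eps * j%:R -> (q <= j)%N}.
Proof.
apply: cid; have [e0|] := boolP (0 < eps); last by exists 0%N.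
have ex : exists q : nat, 1 <= eps * q%:R.
  exists (Num.bound eps^-1); rewrite mulrC -ler_pdivrMr // div1r.
  by rewrite ltW // archi_boundP // invr_ge0 ltW.
by exists (ex_minn ex) => _; case: ex_minnP.
Qed.

End Bounds.

Theorem theorem8p2 (R : realType) (r d d' : nat) (tau : rtype r)
    (hr : 1 <= r) (hd : d' < d)
    (htau : forall B : rooted, tau B -> max_degree (bgraph B) <= d') :
  uniformly_testable_const_time R d (nbhd_free tau).
Proof.
have [B _ tauB] := rtype_emb tau.
have [c [n0 rem]] := removal hr hd htau.
(* This bit depends on [d] and [tau] only, so it can be chosen classically and built into the
   program. *)
pose bad := odd d && ~~ `[< parity_free d tau >].
(* The summand [c] serves large graphs through [removal], and [n0] serves graphs with fewer than
   [n0] vertices. *)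
pose c' := (c + n0).+1.
pose q (eps : R) := sval (ex_inverse_bound eps).
exists (tester r d B bad (c'.*2)), (fun eps => tester_time r d (c'.*2) (q eps)).
move=> eps /andP[eps0 eps1] n G adj dG hadj.
have [hq minq] := svalP (ex_inverse_bound eps) eps0; rewrite -/(q eps) in hq minq.
set T := tester_time _ _ _ _.
have free_set : nbhd_free tau G -> type_set tau G = set0.
  by move=> h; apply/setP => v; rewrite !inE; apply/asboolP/h.
have [n00|npos] := posnP n.
  subst n.
  have E : leads eps d adj 2 (start (tester r d B bad c'.*2))
      ([::], update (fun=> 0) 0 1).
    rewrite -[2]/(1 + 1).
    apply: leads_trans; first exact: leads1.
    by rewrite (eval_not eps 0 _ Nvert) /=; apply: leads1.
  have [p h] := E (T - 2).
  have TE : T = 2 + (T - 2) by rewrite subnKC.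
  split.
  - by rewrite TE h; case: (T - 2).
  - rewrite TE p => _; rewrite (_ : prob _ _ _ _ _ _ = 1)%R; first by lra.
    by case: (T - 2).
  - move=> /(_ G dG); rewrite edit_dist_refl mulr0 ltxx => h'.
    have free : nbhd_free tau G by move=> v; have := ltn_ord v.
    by have := h' free.
have [/andP[bd on]|nbad] := boolP (bad && odd n).
  have E : leads eps d adj 3 (start (tester r d B bad c'.*2)) ([::], fun=> 0).
    rewrite -[3]/(1 + (1 + 1)).
    apply: leads_trans; first exact: leads1.
    rewrite (eval_not eps n _ Nvert) (negbTE (lt0n_neq0 npos)).
    apply: leads_trans; first exact: leads1.
    by rewrite eval_and /= modn2 !eqb0 !negbK bd on; apply: leads1.
  have [p h] := E (T - 3).
  have TE : T = 3 + (T - 3) by rewrite subnKC.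
  split.
  - by rewrite TE h; case: (T - 3).
  - move=> free; case/andP: bd => _ /asboolP[].
    by exists n, G.
  - rewrite TE p => _; rewrite (_ : prob _ _ _ _ _ _ = 1)%R; first by lra.
    by case: (T - 3).
have [halt pr] := @tester_main r d B R eps n G adj tau dG hadj npos
  (fun v => tauB _ G v) bad c'.*2 (q eps) hq minq nbad.
split=> //.
  move=> /free_set S0; rewrite pr /density S0 cards0 mul0r subr0 expr1n; lra.
move=> far; rewrite pr.
have nR : (0 < n%:R :> R)%R by rewrite ltr0n.
have Sn : (#|type_set tau G| <= n)%N.
  by apply: leq_trans (max_card _) _; rewrite card_ord.
have dens01 : (0 <= density R G tau <= 1)%R.
  rewrite /density divr_ge0 ?ler0n //= ler_pdivrMr // mul1r ler_nat //.
suff key : (eps * n%:R <= c'%:R * #|type_set tau G|%:R)%R.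
  suff : ((1 - density R G tau) ^+ (c'.*2 * q eps) <= 1 / 3)%R by lra.
  (* By [key], the [2 c' q] samples times the density are at least [2 eps q], hence at least 2. *)
  apply: miss_prob_le => //.
  rewrite /density mulrA ler_pdivlMr //.
  have : (1 * n%:R <= (eps * (q eps)%:R) * n%:R)%R by rewrite ler_pM2r.
  have : (eps * n%:R * (q eps)%:R <= c'%:R * #|type_set tau G|%:R * (q eps)%:R)%R.
    by rewrite ler_wpM2r.
  rewrite natrM -addnn natrD; lra.
have [nn|nn] := leqP n0 n.
  have par : ~~ odd (d * n) \/ parity_free d tau.
    have [pf|npf] := EM (parity_free d tau); [by right|left].
    by move: nbad; rewrite /bad oddM; case: (odd d) => //=; case: asboolP.
  have [H [dH fH eH]] := rem n G nn par dG.
  (* A far graph needs more than [eps d n >= eps n] edits, while [removal] uses at most [c] per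
     vertex of type [tau]. *)
  have := far H dH fH => lt.
  have : ((edit_dist G H)%:R <= (c * #|type_set tau G|)%:R :> R)%R by rewrite ler_nat.
  have : (eps * n%:R <= eps * d%:R * n%:R)%R.
    rewrite ler_wpM2r //; apply: ler_peMr; [exact: ltW|].
    by rewrite ler1n; apply: leq_ltn_trans hd.
  have : ((c * #|type_set tau G|)%:R <= (c' * #|type_set tau G|)%:R :> R)%R.
    rewrite ler_nat leq_mul2r; apply/orP; right.
    exact: leqW (leq_addr _ _).
  rewrite !natrM; lra.
(* For small [n] one vertex of type [tau] is enough, as [n < n0 <= c']; it exists since a tau-free
   graph is not far. *)
have S1 : (0 < #|type_set tau G|)%N.
  rewrite lt0n cards_eq0; apply/eqP => S0.
  have free : nbhd_free tau G.
    move=> v tv; have : v \in type_set tau G by rewrite inE; apply/asboolP.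
    by rewrite S0 inE.
  have := far G dG free; rewrite edit_dist_refl ltNge !mulr_ge0 ?ler0n // ltW //.
have : (n%:R <= (c' * #|type_set tau G|)%:R :> R)%R.
  rewrite ler_nat; apply: leq_trans (leq_pmulr _ S1).
  exact: leqW (leq_trans (ltnW nn) (leq_addl _ _)).
have : (eps * n%:R <= 1 * n%:R)%R by rewrite ler_wpM2r.
rewrite natrM; lra.
Qed.
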